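(* Let $n\ge 2$, $1\le s\le n$, and let $\underline{k}=(k_1,\dots,k_s)$ with integers $k_i\ge 2$. Let $(p_i)_s$ and $(g_i)_s$ be divergent diagrams of $\underline{k}$-folds on $(\mathbb{C}^n,0)$ associated with the $s$-tuples of reflections $(\alpha_i)_s$ and $(\beta_i)_s$, respectively, where $\alpha_i$ and $\beta_i$ have order $k_i$ for each $i\in\{1,\dots,s\}$. If $(\alpha_i)_s$ and $(\beta_i)_s$ are equivalent, then $(p_i)_s$ and $(g_i)_s$ are equivalent.
   Context: All maps are germs at $0$ of holomorphic maps fixing $0$. A (complex) reflection is a germ of biholomorphism $\varphi:(\mathbb{C}^n,0)\to(\mathbb{C}^n,0)$ of finite order $r\ge 2$ whose fixed-point set is a submanifold (germ) of codimension $1$; it need not be linear. For $k\ge2$, a $k$-fold is a holomorphic germ $f:(\mathbb{C}^n,0)\to(\mathbb{C}^n,0)$ of the form $f=l\circ f_1\circ h^{-1}$, where $f_1(x_1,\dots,x_n)=(x_1^k,x_2,\dots,x_n)$ and $h,l$ are germs of biholomorphisms of $(\mathbb{C}^n,0)$. A divergent diagram of $\underline{k}$-folds is a map germ $(g_i)_s=(g_1,\dots,g_s):(\mathbb{C}^n,0)\to(\mathbb{C}^{ns},0)$ where each $g_i$ is a $k_i$-fold. It is associated with the $s$-tuple of reflections $(\beta_i)_s=(\beta_1,\dots,\beta_s)$ if $g_i\circ\beta_i=g_i$ for all $i$. Two $s$-tuples of reflections $(\alpha_i)_s$ and $(\beta_i)_s$ are equivalent if there is a single germ of biholomorphism $h$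 of $(\mathbb{C}^n,0)$ with $\beta_i=h\circ\alpha_i\circ h^{-1}$ for all $i=1,\dots,s$. Two divergent diagrams of $\underline{k}$-folds $(p_i)_s$ and $(g_i)_s$ are equivalent if there are germs of biholomorphisms $l_1,\dots,l_s$ and $h$ of $(\mathbb{C}^n,0)$ with $g_i=l_i\circ p_i\circ h^{-1}$ for all $i=1,\dots,s$. *)

(* Defs.v *)
From HB Require Import structures.
From mathcomp Require Import all_boot all_order all_algebra.
From mathcomp Require Import complex.
From mathcomp Require Import all_classical all_reals all_analysis.

Set Implicit Arguments.
Unset Strict Implicit.
Unset Printing Implicit Defensive.

Import Order.TTheory GRing.Theory Num.Theory.
Import numFieldNormedType.Exports.

Local Open Scope classical_set_scope.
Local Open Scope ring_scope.

(* The constant keeps the field structure of R[i] visible, so that the normed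
   C-module structures of matrices over numFieldTypes are found on 'rV[CC R]_n.
   Differentiability below is therefore over C, not over R. *)
Definition CC (R : realType) : numClosedFieldType := R[i].

Notation Cn R n := 'rV[CC R]_n.

Section Germs.
Context (R : realType) (n : nat).

(* A germ at 0 is given by a total function representing it; two functions
   represent the same germ when they agree on a neighbourhood of 0.
   Holomorphic germs fixing 0 are continuous at 0, so composing representatives
   represents the composition of the germs. *)
Implicit Types f h phi psi : Cn R n -> Cn R n.

Definition germ_eq (f g : Cn R n -> Cn R n) : Prop := \forall x \near (0 : Cn R n), f x = g x.

Definition holo_germ f : Prop :=
  f 0 = 0 /\ \forall x \near (0 : Cn R n), differentiable f x.

Definition inverse_germs h h' : Prop :=
  [/\ holo_germ h, holo_germ h', germ_eq (h' \o h) id & germ_eq (h \o h') id].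

Definition biholo_germ h : Prop := exists h', inverse_germs h h'.

Definition germ_order phi (r : nat) : Prop :=
  [/\ (0 < r)%N, germ_eq (iter r phi) id &
      forall m, (0 < m < r)%N -> ~ germ_eq (iter m phi) id].

(* S is, near 0, a complex submanifold of codimension d through 0: in some
   system psi of holomorphic coordinates centred at 0 it is the locus where
   the first d coordinates vanish. *)
Definition submanifold_germ (d : nat) (S : set (Cn R n)) : Prop :=
  (d <= n)%N /\
  exists psi, biholo_germ psi /\
    \forall x \near (0 : Cn R n),
      S x <-> forall i : 'I_n, (i < d)%N -> psi x 0 i = 0.

Definition is_reflection phi : Prop :=
  [/\ biholo_germ phi,
      exists2 r, (2 <= r)%N & germ_order phi r &
      submanifold_germ 1 [set x | phi x = x]].

(* (x_1, ..., x_n) |-> (x_1 ^ k, x_2, ..., x_n) *)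
Definition standard_fold (k : nat) (x : Cn R n) : Cn R n :=
  \row_j (if (j == 0 :> nat)%N then x 0 j ^+ k else x 0 j).

Definition is_fold (k : nat) f : Prop :=
  exists l h h', [/\ biholo_germ l, inverse_germs h h' &
                     germ_eq f (l \o standard_fold k \o h')].

(* A map germ (C^n,0) -> (C^(n s),0) = ((C^n)^s,0) is given by the family of its
   s components in C^n. *)
Section Diagrams.
Context (s : nat).
Implicit Types (p g alpha beta : 'I_s -> Cn R n -> Cn R n).

Definition divergent_diagram (k : 'I_s -> nat) g : Prop :=
  forall i, is_fold (k i) (g i).

Definition associated g beta : Prop :=
  forall i, germ_eq (g i \o beta i) (g i).

Definition equivalent_tuples alpha beta : Prop :=
  exists h h', inverse_germs h h' /\
    forall i, germ_eq (beta i) (h \o alpha i \o h').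

Definition equivalent_diagrams p g : Prop :=
  exists (l : 'I_s -> Cn R n -> Cn R n) h h',
    [/\ forall i, biholo_germ (l i), inverse_germs h h' &
        forall i, germ_eq (g i) (l i \o p i \o h')].

End Diagrams.
End Germs.

(* Main.v *)
Require Import Defs.
From mathcomp Require Import all_boot all_order all_algebra.
From mathcomp Require Import ring lra complex.
From mathcomp Require Import all_classical all_reals all_analysis.

Set Implicit Arguments.
Unset Strict Implicit.
Unset Printing Implicit Defensive.

Import Order.TTheory GRing.Theory Num.Theory.
Import numFieldNormedType.Exports.
Import Normc.

Local Open Scope classical_set_scope.
Local Open Scope ring_scope.
Local Open Scope complex_scope.

(* The notations of Num.Theory hide the real-valued parts of [R[i]]. *)
Local Notation Re := (@complex.Re _).
Local Notation Im := (@complex.Im _).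

(** Let [F] be the standard fold. After conjugation by the given biholomorphism,
  both folds are associated with the same reflection [beta], say [p = l1 F A] and
  [g = l2 F E] with [A], [E] biholomorphic. The conjugate [A beta A^-1] preserves [F]
  and has order [k], so it is [x_0 |-> eta x_0] with [eta] a primitive [k]-th root of
  unity. Hence [F E A^-1] is invariant under all [k]-th roots of unity acting on [x_0],
  and factors as [M F]; exchanging the roles of [p] and [g] gives an inverse of [M], so
  [g = (l2 M l1^-1) p].

  The point is that [M], which is [y |-> G (y_0 ^ (1 / k), y_1, ...)] for [G] invariant,
  is holomorphic across the branch locus [y_0 = 0]. This is a removable singularity
  with parameters: the divided differences of order 2 of the slices of [M] in the
  variable [y_0] are bounded by the maximum principle, uniformly in the other variables,
  so that [(M y - M (0, y_1, ...)) / y_0] has a limit at each point of the branch locus.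
  The maximum principle itself, for functions that are differentiable off a
  finite set, comes from the mean value property on circles, which is Goursat's
  theorem on rectangles in logarithmic polar coordinates. *)

(** * Goursat's theorem for pairs of real functions *)

Lemma derivative_upper_bound (R : realType) (f df : R -> R) (a b K : R) : a <= b ->
  (forall x, a <= x <= b -> is_derive x 1 f (df x)) ->
  (forall x, a <= x <= b -> df x <= K) -> f b - f a <= K * (b - a).
Proof.
move=> ab fdf dfK.
have [||c] := @MVT_segment R f df a b ab.
- by move=> x; rewrite in_itv /= => /andP[ax xb]; apply: fdf; rewrite !ltW.
- apply: derivable_within_continuous => x; rewrite in_itv /= => xab.
  by have [] := fdf x xab.
rewrite in_itv /= => cab ->.
by apply: ler_wpM2r (dfK c cab); rewrite subr_ge0.
Qed.

Lemma derivative_norm_bound (R : realType) (f df : R -> R) (a b K : R) : a <= b ->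
  (forall x, a <= x <= b -> is_derive x 1 f (df x)) ->
  (forall x, a <= x <= b -> `|df x| <= K) -> `|f b - f a| <= K * (b - a).
Proof.
move=> ab fdf dfK; rewrite ler_norml; apply/andP; split; last first.
  apply: (derivative_upper_bound ab fdf) => x xab.
  exact: le_trans (ler_norm _) (dfK _ xab).
rewrite lerNl -mulN1r mulrBr !mulN1r.
apply: (@derivative_upper_bound R (- f) (fun x => - df x)) => // x xab.
  have := fdf x xab; exact: is_deriveN.
by rewrite lerNl; have := dfK _ xab; rewrite ler_norml => /andP[].
Qed.

(** Precomposing [f] with the retraction [cl] onto [[a, b]] gives a function continuous on the whole
    line, to which the fundamental theorem of calculus applies. The derivative obtained is
    two-sided, even at the endpoints. *)
Lemma ex_primitive (R : realType) (f : R -> R) (a b : R) :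
  (forall x, a <= x <= b -> {for x, continuous f}) ->
  exists F : R -> R, forall x, a <= x <= b -> is_derive x 1 F (f x).
Proof.
move=> fc; case: (lerP a b) => [ab|ba]; last first.
  by exists id => x /andP[ax xb]; move: (le_lt_trans (le_trans ax xb) ba); rewrite ltxx.
pose cl (x : R) := Num.max a (Num.min b x).
have clab x : a <= cl x <= b.
  by rewrite /cl le_max lexx /= ge_max ab ge_min lexx.
have clid x : a <= x <= b -> cl x = x.
  by move=> /andP[ax xb]; rewrite /cl min_r// max_r.
have clc : continuous cl.
  move=> x; apply: (@continuous_max _ _ (cst a) (fun x => Num.min b x)).
    exact: cst_continuous.
  apply: (@continuous_min _ _ (cst b) id); first exact: cst_continuous.
  by move=> ?; exact: cvg_id.
have fcc : continuous (f \o cl).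
  move=> x; apply: continuous_comp; first exact: clc.
  exact: fc.
(* Integration starts at [a - 1] so that [a] is interior to the domain of integration. *)
exists (fun x => (\int[lebesgue_measure]_(t in `[a - 1, x]) (f \o cl) t)%R) => x xab.
have := @continuous_FTC1_closed R (f \o cl) (a - 1) x (x + 1) _ _ _ (fcc x).
rewrite ltrDl ltr01 => /(_ isT) []; [|by case/andP: xab; lra|].
  apply: continuous_compact_integrable; first exact: segment_compact.
  exact: continuous_subspaceT.
move=> dF FE; apply: DeriveDef => //.
by rewrite -derive1E FE /= clid.
Qed.

(** Bisection in abstract form: a property inherited by one of the four quarters of a rectangle
    holds on arbitrarily small rectangles around some point, the common point of a nested
    sequence. *)
Lemma nested_rectangles (R : realType) (P : R -> R -> R -> R -> Prop) (a b c d : R) :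
  a <= b -> c <= d -> P a b c d ->
  (forall a b c d, a <= b -> c <= d -> P a b c d ->
    let m := (a + b) / 2 in let n := (c + d) / 2 in
    [\/ P a m c n, P m b c n, P a m n d | P m b n d]) ->
  exists x y, [/\ a <= x <= b, c <= y <= d &
    forall e, 0 < e -> exists a' b' c' d',
      [/\ a <= a' /\ b' <= b, c <= c' /\ d' <= d, a' <= x <= b', c' <= y <= d' &
          [/\ b' - a' < e, d' - c' < e & P a' b' c' d']]].
Proof.
move=> ab cd Pab Pbis.
pose rect := (R * R * (R * R))%type.
pose good (q : rect) := [/\ q.1.1 <= q.1.2, q.2.1 <= q.2.2 & P q.1.1 q.1.2 q.2.1 q.2.2].
pose sub (q q' : rect) := [/\ q.1.1 <= q'.1.1 /\ q'.1.2 <= q.1.2,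
   q.2.1 <= q'.2.1 /\ q'.2.2 <= q.2.2,
   q'.1.2 - q'.1.1 = (q.1.2 - q.1.1) / 2 & q'.2.2 - q'.2.1 = (q.2.2 - q.2.1) / 2].
(* Guarding the conclusion by [good q] makes the choice of a quarter a total function, which can be
   iterated. *)
have /choice[step stepP] : forall q, exists q', good q -> good q' /\ sub q q'.
  move=> q; have [gq|] := pselect (good q); last by exists q.
  case: (gq) => q1 q2 Pq.
  have [] := Pbis _ _ _ _ q1 q2 Pq => Pq'.
  - exists ((q.1.1, (q.1.1 + q.1.2) / 2), (q.2.1, (q.2.1 + q.2.2) / 2)) => _.
    by rewrite /good /sub /=; split; split => //; try split; lra.
  - exists (((q.1.1 + q.1.2) / 2, q.1.2), (q.2.1, (q.2.1 + q.2.2) / 2)) => _.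
    by rewrite /good /sub /=; split; split => //; try split; lra.
  - exists ((q.1.1, (q.1.1 + q.1.2) / 2), ((q.2.1 + q.2.2) / 2, q.2.2)) => _.
    by rewrite /good /sub /=; split; split => //; try split; lra.
  - exists (((q.1.1 + q.1.2) / 2, q.1.2), ((q.2.1 + q.2.2) / 2, q.2.2)) => _.
    by rewrite /good /sub /=; split; split => //; try split; lra.
pose s n := iter n step ((a, b), (c, d)).
have sg n : good (s n) by elim: n => [|n IHn] //; have [] := stepP _ IHn.
have ss n : sub (s n) (s n.+1) by have [] := stepP _ (sg n).
have mono (f : nat -> R) : (forall n, f n <= f n.+1) -> forall m n, (m <= n)%N -> f m <= f n.
  by move=> fS m n; apply: (@homo_leq R f <=%O) => //; exact: le_trans.
have a_mono : forall m n, (m <= n)%N -> (s m).1.1 <= (s n).1.1.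
  by apply: mono => n; case: (ss n) => [[]].
have c_mono : forall m n, (m <= n)%N -> (s m).2.1 <= (s n).2.1.
  by apply: mono => n; case: (ss n) => _ [].
have b_mono m n : (m <= n)%N -> (s n).1.2 <= (s m).1.2.
  move=> mn; rewrite -lerN2; apply: (mono (fun n => - (s n).1.2)) mn => k.
  by rewrite lerN2; case: (ss k) => [[]].
have d_mono m n : (m <= n)%N -> (s n).2.2 <= (s m).2.2.
  move=> mn; rewrite -lerN2; apply: (mono (fun n => - (s n).2.2)) mn => k.
  by rewrite lerN2; case: (ss k) => _ [].
have a_le_b m n : (s m).1.1 <= (s n).1.2.
  apply: (le_trans (a_mono _ _ (leq_maxl m n))).
  by apply: le_trans (b_mono _ _ (leq_maxr m n)); case: (sg (maxn m n)).
have c_le_d m n : (s m).2.1 <= (s n).2.2.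
  apply: (le_trans (c_mono _ _ (leq_maxl m n))).
  by apply: le_trans (d_mono _ _ (leq_maxr m n)); case: (sg (maxn m n)).
have limP (f g : nat -> R) : (forall m n, f m <= g n) ->
    exists x, forall n, f n <= x <= g n.
  move=> fg; exists (sup (range f)) => n; apply/andP; split.
    by apply: ub_le_sup; [exists (g 0%N) => _ [m _ <-]|exists n].
  by apply: ge_sup; [exists (f 0%N), 0%N|move=> _ [m _ <-]].
have [x xP] := limP _ _ a_le_b; have [y yP] := limP _ _ c_le_d.
have width n : (s n).1.2 - (s n).1.1 = (b - a) / 2 ^+ n /\
               (s n).2.2 - (s n).2.1 = (d - c) / 2 ^+ n.
  elim: n => [|n [IH1 IH2]]; first by rewrite /= !divr1.
  case: (ss n) => _ _ -> ->; rewrite IH1 IH2 exprSr.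
  by rewrite invfM !mulrA.
exists x, y; split; [exact: (xP 0%N)|exact: (yP 0%N)|] => e e0.
have [N NP] : exists N : nat, (b - a) / 2 ^+ N < e /\ (d - c) / 2 ^+ N < e.
  (* The sum of both sides over [e] is less than [N + 1], hence than [2 ^+ N.+1]; one exponent thus
     serves both sides. *)
  pose N := Num.truncn (((b - a) + (d - c)) / e).
  exists N.+1.
  have H : ((b - a) + (d - c)) / e < 2 ^+ N.+1.
    apply: lt_trans (truncnS_gt _) _.
    by rewrite -natrX ltr_nat ltn_expl.
  have p0 : (0 : R) < 2 ^+ N.+1 by rewrite exprn_gt0.
  rewrite !ltr_pdivrMr//; rewrite ltr_pdivrMr// in H.
  by rewrite [e * _]mulrC; split; apply: le_lt_trans H; lra.
exists (s N).1.1, (s N).1.2, (s N).2.1, (s N).2.2; have [w1 w2] := width N.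
rewrite w1 w2 xP yP; case: NP => N1 N2; case: (sg N) => _ _ PN.
split => //; split.
- exact: (a_mono 0%N).
- exact: (b_mono 0%N).
- exact: (c_mono 0%N).
- exact: (d_mono 0%N).
Qed.

(** Differentiability of the map (U, V) at (x, y) with Jacobian (ux, uy; vx, vy). With the entries
    as explicit arguments, the equation U_x = V_y is stated by repeating one of them. *)
Definition pair_differentiable (R : realType) (U V : R -> R -> R) (x y ux uy vx vy : R) :=
  forall e, 0 < e -> exists2 d, 0 < d & forall h k, `|h| < d -> `|k| < d ->
    `|U (x + h) (y + k) - U x y - (ux * h + uy * k)| <= e * (`|h| + `|k|) /\
    `|V (x + h) (y + k) - V x y - (vx * h + vy * k)| <= e * (`|h| + `|k|).

(** The left-hand side is the integral of V dx + U dy along the boundary of the rectangle. The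
    affine parts of [U] and [V] each contribute [p * (b - a) * (d - c)] and cancel; the increments
    across the rectangle deviate from affine by at most [2 * e], and this error is integrated along
    the sides. *)
Lemma flux_small (R : realType) (U V PU PV : R -> R -> R) (a b c d x0 y0 p q r e : R) :
  a <= b -> c <= d ->
  (forall x y, a <= x <= b -> c <= y <= d ->
    is_derive y 1 (PU x) (U x y) /\ is_derive x 1 (PV y) (V x y)) ->
  (forall x y, a <= x <= b -> c <= y <= d ->
    `|U x y - U x0 y0 - (p * (x - x0) + q * (y - y0))| <= e /\
    `|V x y - V x0 y0 - (r * (x - x0) + p * (y - y0))| <= e) ->
  `|(PU b d - PU b c - (PU a d - PU a c)) - (PV d b - PV d a - (PV c b - PV c a))|
    <= 2 * e * ((b - a) + (d - c)).
Proof.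
move=> ab cd dP UV.
have aab : a <= a <= b by rewrite lexx ab.
have bab : a <= b <= b by rewrite lexx ab.
have ccd : c <= c <= d by rewrite lexx cd.
have dcd : c <= d <= d by rewrite lexx cd.
have HU : `|(PU b d - PU a d - p * (b - a) * d) - (PU b c - PU a c - p * (b - a) * c)|
    <= 2 * e * (d - c).
  apply: (@derivative_norm_bound R (fun y => PU b y - PU a y - p * (b - a) * y)
     (fun y => U b y - U a y - p * (b - a))) => // y ycd.
    have [dPb _] := dP b y bab ycd; have [dPa _] := dP a y aab ycd.
    apply: is_derive_eq; first by rewrite /GRing.scale /= mulr1.
  have [h1 _] := UV b y bab ycd; have [h2 _] := UV a y aab ycd.
  move: h1 h2; rewrite !ler_norml => /andP[? ?] /andP[? ?].
  by apply/andP; split; lra.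
have HV : `|(PV d b - PV c b - p * (d - c) * b) - (PV d a - PV c a - p * (d - c) * a)|
    <= 2 * e * (b - a).
  apply: (@derivative_norm_bound R (fun x => PV d x - PV c x - p * (d - c) * x)
     (fun x => V x d - V x c - p * (d - c))) => // x xab.
    have [_ dPd] := dP x d xab dcd; have [_ dPc] := dP x c xab ccd.
    apply: is_derive_eq; first by rewrite /GRing.scale /= mulr1.
  have [_ h1] := UV x d xab dcd; have [_ h2] := UV x c xab ccd.
  move: h1 h2; rewrite !ler_norml => /andP[? ?] /andP[? ?].
  by apply/andP; split; lra.
move: HU HV; rewrite !ler_norml => /andP[? ?] /andP[? ?].
by apply/andP; split; lra.
Qed.

(* Goursat's bisection argument: only the pointwise equality [U_x = V_y] is used,
   not the continuity of these partial derivatives. *)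
Lemma flux_eq0 (R : realType) (U V PU PV : R -> R -> R) (a b c d : R) :
  a <= b -> c <= d ->
  (forall x y, a <= x <= b -> c <= y <= d ->
    is_derive y 1 (PU x) (U x y) /\ is_derive x 1 (PV y) (V x y)) ->
  (forall x y, a <= x <= b -> c <= y <= d ->
    exists p q r, pair_differentiable U V x y p q r p) ->
  PU b d - PU b c - (PU a d - PU a c) = PV d b - PV d a - (PV c b - PV c a).
Proof.
move=> ab cd dP dUV.
pose flux a b c d :=
  (PU b d - PU b c - (PU a d - PU a c)) - (PV d b - PV d a - (PV c b - PV c a)).
apply/eqP; rewrite -subr_eq0 -/(flux a b c d); apply/negP => /negP flux0.
have L0 : 0 <= (b - a) + (d - c) by lra.
(* The [+ 1] keeps the denominator positive for a degenerate rectangle and makes the initial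
   instance of [P] strict. *)
pose e := `|flux a b c d| / (((b - a) + (d - c)) ^+ 2 + 1).
have den0 : 0 < ((b - a) + (d - c)) ^+ 2 + 1 by rewrite ltr_wpDl// sqr_ge0.
have e0 : 0 < e by rewrite divr_gt0// normr_gt0.
(* Bisection divides the square of the half-perimeter by 4 and [flux] is additive, so one of the
   four quarters inherits [P]. *)
pose P a b c d := e * ((b - a) + (d - c)) ^+ 2 < `|flux a b c d|.
have [||x [y [xab ycd small]]] := @nested_rectangles R P a b c d ab cd.
- rewrite /P /e -mulrA gtr_pMr ?normr_gt0// mulrC ltr_pdivrMr// mul1r.
  by rewrite ltrDl.
- move=> a1 b1 c1 d1 ab1 cd1 P1 m n.
  have fluxE : flux a1 b1 c1 d1 =
      flux a1 m c1 n + flux m b1 c1 n + (flux a1 m n d1 + flux m b1 n d1).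
    by rewrite /flux; ring.
  apply: contrapT => nP.
  have [n1 n2 n3 n4] : [/\ ~ P a1 m c1 n, ~ P m b1 c1 n, ~ P a1 m n d1 & ~ P m b1 n d1].
    by split=> ?; apply: nP; [constructor 1|constructor 2|constructor 3|constructor 4].
  move: P1; apply/negP; rewrite -leNgt fluxE.
  move: n1 n2 n3 n4; rewrite /P => /negP + /negP + /negP + /negP.
  rewrite -!leNgt => n1 n2 n3 n4.
  apply: (le_trans (ler_normD _ _)).
  apply: (le_trans (lerD (ler_normD _ _) (ler_normD _ _))).
  apply: (le_trans (lerD (lerD n1 n2) (lerD n3 n4))).
  by rewrite le_eqVlt; apply/orP; left; apply/eqP; rewrite /m /n; field.
(* An expansion at the limit point to precision [e / 2] bounds the flux of a small rectangle by [e]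
   times the square of its half-perimeter, against [P]. *)
have [p [q [r]]] := dUV x y xab ycd => /(_ (e / 2) (divr_gt0 e0 (ltr0Sn R 1))) [dl dl0 near_xy].
have [a1 [b1 [c1 [d1 [[aa bb] [cc dd] /andP[ax xb] /andP[cy yd] [w1 w2]]]]]] := small dl dl0.
apply/negP; rewrite -leNgt.
have := @flux_small R U V PU PV a1 b1 c1 d1 x y p q r (e / 2 * ((b1 - a1) + (d1 - c1))).
rewrite -/(flux a1 b1 c1 d1) => H.
suff : `|flux a1 b1 c1 d1| <= 2 * (e / 2 * (b1 - a1 + (d1 - c1))) * (b1 - a1 + (d1 - c1)).
  move/le_trans; apply; rewrite le_eqVlt; apply/orP; left; apply/eqP; by field.
apply: H; [lra|lra| |].
- move=> x1 y1 /andP[? ?] /andP[? ?]; apply: dP; apply/andP; split; lra.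
- move=> x1 y1 /andP[ax1 xb1] /andP[cy1 yd1].
  have hn : `|x1 - x| <= b1 - a1 by rewrite ler_norml; apply/andP; split; lra.
  have kn : `|y1 - y| <= d1 - c1 by rewrite ler_norml; apply/andP; split; lra.
  have [] := near_xy (x1 - x) (y1 - y) (le_lt_trans hn w1) (le_lt_trans kn w2).
  rewrite !(addrCA x) !(addrCA y) !subrr !addr0 => h1 h2.
  have bd : e / 2 * (`|x1 - x| + `|y1 - y|) <= e / 2 * (b1 - a1 + (d1 - c1)).
    by apply: ler_wpM2l; [rewrite ltW// divr_gt0|exact: lerD].
  by split; [apply: le_trans h1 bd|apply: le_trans h2 bd].
Qed.

(** * Differentiability *)

Section Differentiable.
Variables (K : numFieldType) (V W : normedModType K).
Implicit Types (f g : V -> W) (x : V).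

Lemma differentiable_expansion f x : differentiable f x -> forall e : K, 0 < e ->
  \forall y \near x, `|f y - f x - 'd f x (y - x)| <= e * `|y - x|.
Proof.
move=> /diff_locally /eqaddoP df e e0.
rewrite (near_shift 0 x) subr0; move: (df e e0); apply: filterS => y /=.
by rewrite /= addrK !fctE /= opprD addrA.
Qed.

Lemma differentiable_of_expansion f x (L : {linear V -> W}) : continuous L ->
  (forall e : K, 0 < e -> \forall y \near x, `|f y - f x - L (y - x)| <= e * `|y - x|) ->
  differentiable f x.
Proof.
move=> Lc fL.
have fxL : f \o shift x = cst (f x) + L +o_ (0 : V) id.
  apply/eqaddoP => e e0; move: (fL e e0); rewrite (near_shift 0 x) subr0.
  by apply: filterS => y /=; rewrite addrK !fctE /= opprD addrA.
by apply/diff_locallyP; rewrite (diff_unique Lc fxL).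
Qed.

Lemma differentiable_near_eq f g x : (\forall y \near x, f y = g y) ->
  differentiable f x -> differentiable g x.
Proof.
move=> fg df; apply: (@differentiable_of_expansion _ _ ('d f x)).
  exact: diff_continuous.
move=> e e0; near=> y.
have <- : f y = g y by near: y.
rewrite -(nbhs_singleton fg).
near: y; exact: differentiable_expansion.
Unshelve. all: by end_near. Qed.

End Differentiable.

(** * Mean value property *)

Section ComplexNorm.
Variable R : realType.
Implicit Types z w : CC R.

Lemma normC_normc z : `|z| = (normc z)%:C. Proof. by case: z. Qed.

Lemma normc_ge0 z : 0 <= normc z. Proof. by rewrite -ler0c -normC_normc. Qed.

Lemma normc_triangle z w : normc (z + w) <= normc z + normc w.
Proof. exact: le_normcD. Qed.

Lemma normc_eq0 z : (normc z == 0) = (z == 0).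
Proof.
apply/eqP/eqP => [|->]; first exact: eq0_normc.
exact: normc0.
Qed.

Lemma norm_Re_le z : `|Re z| <= normc z.
Proof. by rewrite -lecR -normC_normc; apply: normc_ge_Re. Qed.

Lemma norm_Im_le z : `|Im z| <= normc z.
Proof.
case: z => x y /=; rewrite -sqrtr_sqr ler_sqrt ?addr_ge0 ?sqr_ge0//.
by rewrite lerDr sqr_ge0.
Qed.

Lemma normc_real (x : R) : normc (x%:C) = `|x|.
Proof. by rewrite /= expr0n addr0 sqrtr_sqr. Qed.

Lemma normc_le_ReIm z : normc z <= `|Re z| + `|Im z|.
Proof.
case: z => x y /=; rewrite -[leRHS]ger0_norm ?addr_ge0// -sqrtr_sqr.
rewrite ler_sqrt ?sqr_ge0// sqrrD !real_normK ?num_real//.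
by rewrite lerD2r lerDl mulrn_wge0// mulr_ge0.
Qed.

Lemma ltC_gt0 (x : CC R) : 0 < x -> exists2 e : R, 0 < e & x = e%:C.
Proof. by rewrite ltcE /= => /andP[/eqP]; case: x => a b /= -> ; exists a. Qed.

Lemma nbhs_normcP z (P : set (CC R)) :
  nbhs z P <-> exists2 d : R, 0 < d & forall w, normc (w - z) < d -> P w.
Proof.
split=> [/nbhs_normP[_ /= /ltC_gt0[d d0 ->] dP]|[d d0 dP]].
  by exists d => // w wz; apply: dP; rewrite /= distrC normC_normc ltcR.
apply/nbhs_normP; exists d%:C; first by rewrite /= ltcR.
by move=> w /=; rewrite distrC normC_normc ltcR; apply: dP.
Qed.

(** The differential is linear over [CC R], hence is multiplication by its value at 1. The
    Cauchy-Riemann equations used below come from this. *)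
Lemma differentiable_normc_expansion (f : CC R -> CC R) z : differentiable f z ->
  exists D : CC R, forall e : R, 0 < e -> exists2 d, 0 < d &
    forall w, normc w < d -> normc (f (z + w) - f z - D * w) <= e * normc w.
Proof.
move=> df; exists ('d f z 1) => e e0.
have e0C : 0 < e%:C :> CC R by rewrite ltcR.
have /nbhs_normcP[d d0 dP] := differentiable_expansion df e0C.
exists d => // w wd; have := dP (z + w); rewrite addrAC subrr add0r => /(_ wd).
have -> : 'd f z w = 'd f z 1 * w.
  by rewrite mulrC -[RHS]/(w *: 'd f z 1) -linearZ /= [w *: _]mulr1.
by rewrite !normC_normc -rmorphM lecR.
Qed.

End ComplexNorm.

Lemma is_derive_expansion (R : realType) (f : R -> R) (x f' : R) : is_derive x 1 f f' ->
  forall e, 0 < e -> exists2 d, 0 < d &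
    forall h, `|h| < d -> `|f (x + h) - f x - f' * h| <= e * `|h|.
Proof.
move=> [df Df] e e0; have /derivable1_diffP dff := df.
have /nbhs_normP[d /= d0 dP] := differentiable_expansion dff e0.
exists d => // h hd; have := dP (x + h) => /=.
rewrite opprD addNKr normrN => /(_ hd).
rewrite [x + h]addrC addrK [h + x]addrC.
have -> // : 'd f x h = f' * h.
by rewrite mulrC -[RHS]/(h *: f') -Df deriveE// -linearZ /= [h *: _]mulr1.
Qed.

(** * Logarithmic polar coordinates *)

Section Polar.
Variable R : realType.

(** The complex exponential of s + it: [s] is the logarithm of the radius and [t] the angle. *)
Definition cexp (s t : R) : CC R := (expR s * cos t) +i* (expR s * sin t).

Lemma cexpD s h t k : cexp (s + h) (t + k) = cexp s t * cexp h k.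
Proof.
rewrite /cexp expRD cosD sinD; apply/eqP; rewrite eq_complex /=.
by apply/andP; split; apply/eqP; ring.
Qed.

Lemma normc_cexp s t : normc (cexp s t) = expR s.
Proof.
by rewrite /= !exprMn -mulrDr cos2Dsin2 mulr1 sqrtr_sqr ger0_norm//.
Qed.

Lemma cexp_periodic s t : cexp s (t + pi *+ 2) = cexp s t.
Proof. by rewrite /cexp cosD2pi sinD2pi. Qed.

Lemma cexp_expansion0 (e : R) : 0 < e -> exists2 d, 0 < d & forall h k,
  `|h| < d -> `|k| < d -> normc (cexp h k - 1 - (h +i* k)) <= e * (`|h| + `|k|).
Proof.
(* The 8 is the final coefficient of [e' * |k|]: 3 and 3 from the errors of [cos] and [sin], and 2
   from the product [(h + a) * k]. *)
move=> e0; have [e' [e'0 e'1 e'e]] : exists e' : R, [/\ 0 < e', e' <= 1 & 8 * e' <= e].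
  exists (Num.min 1 (e / 8)); rewrite lt_min ltr01 divr_gt0// ge_min lexx; split => //.
  have : Num.min 1 (e / 8) <= e / 8 by rewrite ge_min lexx orbT.
  lra.
have [d1 d10 exph] := is_derive_expansion (is_derive_expR 0) e'0.
have [d2 d20 cosk] := is_derive_expansion (is_derive_cos 0) e'0.
have [d3 d30 sink] := is_derive_expansion (is_derive_sin 0) e'0.
exists (Num.min (Num.min d1 d2) (Num.min d3 e')).
  by rewrite !lt_min d10 d20 d30 e'0.
move=> h k; rewrite !lt_min => /andP[/andP[h1 _] /andP[_ he]] /andP[/andP[_ k2] /andP[k3 _]].
have := exph h h1; have := cosk k k2; have := sink k k3.
rewrite !add0r expR0 cos0 sin0 !mul1r oppr0 mul0r !subr0 => {exph cosk sink}.
set a := _ - h; set b := _ - 1; set c := _ - k => sink cosk exph.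
have -> : cexp h k - 1 - (h +i* k) = (a + (1 + h + a) * b) +i* ((h + a) * k + (1 + h + a) * c).
  apply/eqP; rewrite eq_complex /=; rewrite /a /b /c oppr0 addr0.
  by apply/andP; split; apply/eqP; ring.
apply: (le_trans (normc_le_ReIm _)) => /=.
have h0 := normr_ge0 h; have k0 := normr_ge0 k.
have ha : `|h + a| <= 2 * e'.
  apply: (le_trans (ler_normD _ _)).
  have : e' * `|h| <= 1 * `|h| by apply: ler_wpM2r.
  lra.
have h1a : `|1 + h + a| <= 3.
  by rewrite -addrA; apply: (le_trans (ler_normD _ _)); rewrite normr1; lra.
have B : `|(1 + h + a) * b| <= 3 * (e' * `|k|).
  by rewrite normrM; apply: ler_pM.
have C : `|(1 + h + a) * c| <= 3 * (e' * `|k|).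
  by rewrite normrM; apply: ler_pM.
have D : `|(h + a) * k| <= 2 * e' * `|k| by rewrite normrM; apply: ler_wpM2r.
have E : 8 * e' * (`|h| + `|k|) <= e * (`|h| + `|k|).
  by apply: ler_wpM2r => //; exact: addr_ge0.
have F1 := ler_normD a ((1 + h + a) * b).
have F2 := ler_normD ((h + a) * k) ((1 + h + a) * c).
have G : 0 <= e' * `|h| by apply: mulr_ge0 => //; exact: ltW.
lra.
Qed.

(* Cauchy-Riemann equations in logarithmic polar coordinates:
   [Re f] and [Im f] satisfy [U_s = V_t] along [z0 + exp (s + it)]. *)
Lemma polar_pair_differentiable (f : CC R -> CC R) (z0 : CC R) (s t : R) :
  differentiable f (z0 + cexp s t) -> exists p q r,
  pair_differentiable (fun s t => Re (f (z0 + cexp s t)))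
    (fun s t => Im (f (z0 + cexp s t))) s t p q r p.
Proof.
move=> /differentiable_normc_expansion[D fD].
pose w := D * cexp s t.
(* By the chain rule [w] is the complex derivative with respect to s + it, so U_s = V_t = Re w and
   V_s = - U_t = Im w. *)
exists (Re w), (- Im w), (Im w) => e e0.
pose m := expR s.
have m0 : 0 < m by exact: expR_gt0.
have N0 := normc_ge0 D.
pose e1 := e / (2 * (m + 1)).
have e10 : 0 < e1 by rewrite divr_gt0// mulr_gt0// addr_gt0.
have [d1 d10 fd1] := fD e1 e10.
(* The first bound makes the increment [v] at most [(m + 1) * L], so that the error of [f] costs
   [e / 2]; the second makes the error of [cexp], multiplied by [D], cost the other [e / 2]. *)
pose e2 := Num.min (1 / m) (e / (2 * m * (normc D + 1))).
have e20 : 0 < e2.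
  by rewrite lt_min !divr_gt0// !mulr_gt0// ltr_wpDl.
have [d2 d20 cd2] := cexp_expansion0 e20.
exists (Num.min d2 (d1 / (2 * (m + 1)))).
  by rewrite lt_min d20 divr_gt0// mulr_gt0// addr_gt0.
move=> h k; rewrite !lt_min => /andP[h2 h1] /andP[k2 k1].
set L := `|h| + `|k|.
have L0 : 0 <= L by exact: addr_ge0.
pose D1 := cexp h k - 1 - (h +i* k).
have D1L : normc D1 <= e2 * L by exact: cd2.
pose v := cexp (s + h) (t + k) - cexp s t.
have vE : v = cexp s t * (h +i* k) + cexp s t * D1.
  by rewrite /v cexpD /D1; ring.
have hkL : normc (h +i* k) <= L := normc_le_ReIm (h +i* k).
have mD1 : normc (cexp s t * D1) <= m * (e2 * L).
  by rewrite normcM normc_cexp; apply: ler_wpM2l => //; exact: ltW.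
have me2 : m * e2 <= 1.
  have : e2 <= 1 / m by rewrite ge_min lexx.
  by rewrite ler_pdivlMr// mulrC.
have vL : normc v <= (m + 1) * L.
  rewrite vE; apply: (le_trans (normc_triangle _ _)).
  rewrite mulrDl; apply: lerD.
    by rewrite normcM normc_cexp; apply: ler_wpM2l => //; exact: ltW.
  by apply: (le_trans mD1); rewrite mulrA; apply: ler_wpM2r.
have vd1 : normc v < d1.
  apply: (le_lt_trans vL).
  have : L < d1 / (m + 1).
    have -> : d1 / (m + 1) = d1 / (2 * (m + 1)) + d1 / (2 * (m + 1)).
      by field; rewrite gt_eqF// addr_gt0.
    exact: ltrD.
  by rewrite ltr_pdivlMr ?addr_gt0// mulrC.
pose T := f (z0 + cexp s t + v) - f (z0 + cexp s t) - w * (h +i* k).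
have TL : normc T <= e * L.
  have -> : T = (f (z0 + cexp s t + v) - f (z0 + cexp s t) - D * v) + D * (cexp s t * D1).
    by rewrite /T vE /w; ring.
  apply: (le_trans (normc_triangle _ _)).
  have -> : e * L = e / 2 * L + e / 2 * L by field.
  apply: lerD.
    apply: (le_trans (fd1 _ vd1)).
    have : e1 * normc v <= e1 * ((m + 1) * L) by apply: ler_wpM2l => //; exact: ltW.
    move/le_trans; apply; rewrite le_eqVlt; apply/orP; left; apply/eqP.
    by rewrite /e1; field; rewrite gt_eqF// addr_gt0.
  rewrite normcM.
  have : normc D * normc (cexp s t * D1) <= normc D * (m * (e2 * L)).
    by apply: ler_wpM2l.
  move/le_trans; apply; rewrite !mulrA; apply: ler_wpM2r => //.
  have e2e : e2 <= e / (2 * m * (normc D + 1)) by rewrite ge_min lexx orbT.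
  apply: (@le_trans _ _ ((normc D + 1) * m * e2)).
    by rewrite -!mulrA; apply: ler_wpM2r; [rewrite mulr_ge0// ltW|rewrite lerDl].
  have : (normc D + 1) * m * e2 <= (normc D + 1) * m * (e / (2 * m * (normc D + 1))).
    apply: ler_wpM2l => //; rewrite mulr_ge0 ?addr_ge0//; exact: ltW.
  move/le_trans; apply; rewrite le_eqVlt; apply/orP; left; apply/eqP.
  by field; rewrite !gt_eqF// ltr_wpDl.
have zv : z0 + cexp s t + v = z0 + cexp (s + h) (t + k).
  by rewrite /v; ring.
split.
  have -> : Re (f (z0 + cexp (s + h) (t + k))) - Re (f (z0 + cexp s t))
      - (Re w * h + - Im w * k) = Re T.
    rewrite /T zv; case: w {T TL zv fd1 vE} => a b; case: (f (z0 + cexp (s + h) (t + k))) => a1 b1.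
    by case: (f _) => a2 b2 /=; ring.
  exact: le_trans (norm_Re_le _) TL.
have -> : Im (f (z0 + cexp (s + h) (t + k))) - Im (f (z0 + cexp s t))
    - (Im w * h + Re w * k) = Im T.
  rewrite /T zv; case: w {T TL zv fd1 vE} => a b; case: (f (z0 + cexp (s + h) (t + k))) => a1 b1.
  by case: (f _) => a2 b2 /=; ring.
exact: le_trans (norm_Im_le _) TL.
Qed.

End Polar.

Lemma locally_lipschitz_continuous (R : realType) (g : R -> R) (x K d : R) : 0 < d ->
  (forall h, `|h| < d -> `|g (x + h) - g x| <= K * `|h|) -> {for x, continuous g}.
Proof.
move=> d0 gK; apply/cvgrPdist_le => e e0.
pose K' := `|K| + 1; have K'0 : 0 < K' by rewrite ltr_wpDl.
apply/nbhs_normP; exists (Num.min d (e / K')); first by rewrite /= lt_min d0 divr_gt0.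
move=> y /=; rewrite distrC lt_min => /andP[yd ye].
have := gK (y - x) yd; rewrite [x + _]addrC subrK distrC => /le_trans; apply.
apply: (@le_trans _ _ (K' * `|y - x|)).
  by apply: ler_wpM2r => //; have := ler_norm K; rewrite /K'; lra.
by rewrite mulrC -ler_pdivlMr// ltW.
Qed.

Lemma pair_differentiable_continuous (R : realType) (U V : R -> R -> R) x y ux uy vx vy :
  pair_differentiable U V x y ux uy vx vy ->
  {for y, continuous (U x)} /\ {for x, continuous (V^~ y)}.
Proof.
move=> /(_ 1 ltr01)[d d0 UV]; split.
  apply: (@locally_lipschitz_continuous _ _ _ (`|uy| + 1) d) => // k kd.
  have [|H _] := UV 0 k _ kd; first by rewrite normr0.
  rewrite normr0 addr0 mulr0 !add0r mul1r in H.
  have -> : U x (y + k) - U x y = (U x (y + k) - U x y - uy * k) + uy * k by ring.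
  apply: (le_trans (ler_normD _ _)); rewrite normrM mulrDl mul1r addrC.
  exact: lerD.
apply: (@locally_lipschitz_continuous _ _ _ (`|vx| + 1) d) => // k kd.
have [|_ H] := UV k 0 kd; first by rewrite normr0.
rewrite normr0 !addr0 mulr0 addr0 mul1r in H.
have -> : V (x + k) y - V x y = (V (x + k) y - V x y - vx * k) + vx * k by ring.
apply: (le_trans (ler_normD _ _)); rewrite normrM mulrDl mul1r addrC.
exact: lerD.
Qed.

(** * Means over circles in a punctured disc *)

Section CircleMean.
Variables (R : realType) (f : CC R -> CC R) (z0 : CC R) (rho : R).
Hypothesis f_diff : forall z, 0 < normc (z - z0) < rho -> differentiable f z.
Local Notation U := (fun s t => Re (f (z0 + cexp s t))).
Local Notation V := (fun s t => Im (f (z0 + cexp s t))).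

Let CR s t : expR s < rho -> exists p q r, pair_differentiable U V s t p q r p.
Proof.
move=> srho; apply: polar_pair_differentiable; apply: f_diff.
by rewrite addrAC subrr add0r normc_cexp expR_gt0.
Qed.

Lemma circle_primitive s : expR s < rho ->
  exists F : R -> R, forall t, 0 <= t <= pi *+ 2 -> is_derive t 1 F (U s t).
Proof.
move=> srho; apply: (@ex_primitive R (U s)) => t _.
have [p [q [r d]]] := CR t srho.
exact: (pair_differentiable_continuous d).1.
Qed.

(** [flux_eq0] on the rectangle from [s1] to [s2] and from 0 to 2 pi: the sides t = 0 and t = 2 pi
    cancel by periodicity, leaving the integrals over the two circles. *)
Lemma circle_integral_cst s1 s2 F1 F2 : s1 <= s2 -> expR s2 < rho ->
  (forall t, 0 <= t <= pi *+ 2 -> is_derive t 1 F1 (U s1 t)) ->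
  (forall t, 0 <= t <= pi *+ 2 -> is_derive t 1 F2 (U s2 t)) ->
  F1 (pi *+ 2) - F1 0 = F2 (pi *+ 2) - F2 0.
Proof.
move=> s12 s2rho dF1 dF2.
have srho s : s1 <= s <= s2 -> expR s < rho.
  by move=> /andP[_ ss2]; apply: le_lt_trans s2rho; rewrite ler_expR.
(* The primitive is chosen as a function of [g] alone. The slices of [V] at 0 and 2 pi, being equal
   functions, get the same primitive, and their terms cancel. *)
have /choice[P PP] : forall g : R -> R, exists F : R -> R,
    (forall x, s1 <= x <= s2 -> {for x, continuous g}) ->
    forall x, s1 <= x <= s2 -> is_derive x 1 F (g x).
  move=> g; have [gc|] := pselect (forall x, s1 <= x <= s2 -> {for x, continuous g}).
    by have [F FP] := ex_primitive gc; exists F.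
  by exists id.
have /choice[Q QP] : forall s, exists F : R -> R, s1 <= s <= s2 ->
    forall t, 0 <= t <= pi *+ 2 -> is_derive t 1 F (U s t).
  move=> s; have [ss|] := pselect (s1 <= s <= s2); last by exists id.
  have [-> |ns1] := eqVneq s s1; first by exists F1.
  by have [F FP] := circle_primitive (srho _ ss); exists F.
have pi20 : 0 <= pi *+ 2 :> R by rewrite mulrn_wge0// pi_ge0.
have := @flux_eq0 R U V Q (fun t => P (fun s => V s t)) s1 s2 0 (pi *+ 2) s12 pi20.
have V2pi : (fun s => V s (pi *+ 2)) = (fun s => V s 0).
  by apply/funext => s; rewrite -[pi *+ 2]add0r cexp_periodic.
rewrite V2pi subrr => /(_ _ _)/eqP; rewrite subr_eq0 => /(_ _ _)/eqP H.
(* Two primitives of the same function have the same increment, so the chosen [Q s] can be replaced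
   by the given [F1] and [F2]. *)
have uniq s F : s1 <= s <= s2 -> (forall t, 0 <= t <= pi *+ 2 -> is_derive t 1 F (U s t)) ->
    Q s (pi *+ 2) - Q s 0 = F (pi *+ 2) - F 0.
  move=> ss dF; apply/eqP; rewrite -subr_eq0 -normr_le0.
  have := @derivative_norm_bound R (Q s - F) (fun t => U s t - U s t) 0 (pi *+ 2) 0 pi20.
  rewrite mul0r !fctE /= => K.
  have -> : Q s (pi *+ 2) - Q s 0 - (F (pi *+ 2) - F 0) =
            Q s (pi *+ 2) - F (pi *+ 2) - (Q s 0 - F 0) by ring.
  apply: K => [t tt|t _]; last by rewrite subrr normr0.
  have := QP s ss t tt; have := dF t tt => dF' dQ.
  exact: is_deriveB.
rewrite -(uniq s1 F1) ?lexx// -(uniq s2 F2) ?lexx ?s12//.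
symmetry; apply: H.
  move=> x y xs yt; split; first exact: QP.
  apply: (PP (fun s => V s y)) => // s ss.
  have [p [q [r d]]] := CR y (srho _ ss).
  exact: (pair_differentiable_continuous d).2.
by move=> x y xs _; apply: CR; exact: srho.
Qed.

Hypothesis f_cont : {for z0, continuous f}.

(** The integral does not depend on the radius; shrinking the circle, it is evaluated by continuity
    at the centre. *)
Lemma circle_mean s F : expR s < rho ->
  (forall t, 0 <= t <= pi *+ 2 -> is_derive t 1 F (U s t)) ->
  F (pi *+ 2) - F 0 = pi *+ 2 * Re (f z0).
Proof.
move=> srho dF; have pi20 : 0 < pi *+ 2 :> R by rewrite mulrn_wgt0// pi_gt0.
apply/eqP; rewrite -subr_eq0 -normr_le0; apply/ler_addgt0Pl => e e0; rewrite addr0.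
pose e' := e / (pi *+ 2); have e'0 : 0 < e' by exact: divr_gt0.
have : nbhs z0 [set z | `|f z0 - f z| <= e'%:C].
  by move/cvgrPdist_le : f_cont; apply; rewrite ltcR.
move=> /nbhs_normcP[d d0 dP].
pose s1 := Num.min s (ln (d / 2)).
have s1s : s1 <= s by rewrite ge_min lexx.
have s1d : expR s1 < d.
  apply: (@le_lt_trans _ _ (expR (ln (d / 2)))); first by rewrite ler_expR ge_min lexx orbT.
  by rewrite lnK ?posrE ?divr_gt0//; lra.
have [F1 dF1] : exists F1 : R -> R, forall t, 0 <= t <= pi *+ 2 -> is_derive t 1 F1 (U s1 t).
  by apply: circle_primitive; apply: le_lt_trans srho; rewrite ler_expR.
rewrite -(circle_integral_cst s1s srho dF1 dF).
have := @derivative_norm_bound R (fun t => F1 t - Re (f z0) * t)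
  (fun t => U s1 t - Re (f z0)) 0 (pi *+ 2) e' (ltW pi20).
rewrite mulr0 !subr0 => K.
have -> : F1 (pi *+ 2) - F1 0 - pi *+ 2 * Re (f z0) = F1 (pi *+ 2) - Re (f z0) * (pi *+ 2) - F1 0.
  by ring.
have <- : e' * (pi *+ 2) = e by rewrite /e' divfK// gt_eqF.
apply: K => [t tt|t _].
  have := dF1 t tt => dF1t.
  by apply: is_derive_eq; first by rewrite /GRing.scale /= mulr1.
have := dP (z0 + cexp s1 t); rewrite addrAC subrr add0r normc_cexp => /(_ s1d) /=.
rewrite normC_normc lecR distrC; apply: le_trans.
by apply: le_trans (norm_Re_le _); case: (f _); case: (f _).
Qed.

End CircleMean.

(** * Maximum principle and removable singularities *)

Section MaximumPrinciple.
Variable R : realType.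
Implicit Types (f : CC R -> CC R) (z : CC R) (E : seq (CC R)).

(** Squares stand in for discs: they are compact as products of segments, and their boundary points
    still have modulus at least [r]. *)
Definition box (r : R) z := (`|Re z| <= r) && (`|Im z| <= r).
Definition open_box (r : R) z := (`|Re z| < r) && (`|Im z| < r).

Lemma open_box_sub r z : open_box r z -> box r z.
Proof. by move=> /andP[? ?]; apply/andP; split; apply: ltW. Qed.

Lemma box_boundary r z : box r z -> ~~ open_box r z -> r <= normc z.
Proof.
rewrite /open_box negb_and -!leNgt => _ /orP[] /le_trans; apply.
  exact: norm_Re_le.
exact: norm_Im_le.
Qed.

Lemma continuous_normcP f z : {for z, continuous f} -> forall e : R, 0 < e ->
  exists2 d : R, 0 < d & forall w, normc (w - z) < d -> normc (f w - f z) <= e.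
Proof.
move=> /cvgrPdist_le fz e e0.
have /fz/nbhs_normcP[d d0 dP] : 0 < e%:C :> CC R by rewrite ltcR.
by exists d => // w /dP; rewrite normC_normc lecR -normcN opprB.
Qed.

Lemma punctured_ball_avoids E z : exists2 rho : R, 0 < rho &
  forall w, w \in E -> w != z -> rho <= normc (w - z).
Proof.
elim: E => [|x E [rho rho0 IH]]; first by exists 1.
have [->|xz] := eqVneq x z.
  exists rho => // w; rewrite inE => /orP[/eqP ->|]; [by rewrite eqxx|exact: IH].
exists (Num.min rho (normc (x - z))).
  by rewrite lt_min rho0 lt_def normc_ge0 normc_eq0 subr_eq0 xz.
move=> w; rewrite inE => /orP[/eqP -> _|wE wz]; first by rewrite ge_min lexx orbT.
by rewrite ge_min IH.
Qed.

(* Adding [e |z|^2] turns the mean value property into a strict inequality,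
   which forbids an interior maximum. *)
Lemma interior_no_strict_max f z0 E (r e : R) : 0 < e -> open_box r z0 ->
  (forall z, box r z -> {for z, continuous f}) ->
  (forall z, open_box r z -> z \notin E -> differentiable f z) ->
  (forall z, box r z -> Re (f z) + e * (Re z ^+ 2 + Im z ^+ 2) <=
                        Re (f z0) + e * (Re z0 ^+ 2 + Im z0 ^+ 2)) -> False.
Proof.
move=> e0 z0r fc fd fmax.
have [rho rho0 rhoE] := punctured_ball_avoids E z0.
case/andP: (z0r) => zx zy.
pose rho' := Num.min rho (Num.min (r - `|Re z0|) (r - `|Im z0|)).
have rho'0 : 0 < rho' by rewrite !lt_min rho0 !subr_gt0 zx zy.
have in_box z : normc (z - z0) < rho' -> open_box r z.
  rewrite !lt_min => /andP[_ /andP[zr1 zr2]].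
  have h1 := norm_Re_le (z - z0); have h2 := norm_Im_le (z - z0).
  have Rz : Re z = Re (z - z0) + Re z0 by rewrite -[in LHS](subrK z0 z); case: (z - z0); case: (z0).
  have Iz : Im z = Im (z - z0) + Im z0 by rewrite -[in LHS](subrK z0 z); case: (z - z0); case: (z0).
  by rewrite /open_box Rz Iz; apply/andP; split; apply: (le_lt_trans (ler_normD _ _)); lra.
have fd' z : 0 < normc (z - z0) < rho' -> differentiable f z.
  move=> /andP[z1 z2]; apply: fd; first exact: in_box.
  apply/negP => zE; move: z2; apply/negP; rewrite -leNgt.
  rewrite ge_min rhoE// -subr_eq0 -normc_eq0; exact: lt0r_neq0.
pose s := ln (rho' / 2); pose m := expR s.
have m0 : 0 < m by exact: expR_gt0.
have mrho : m < rho' by rewrite /m lnK ?posrE ?divr_gt0//; lra.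
have [F dF] := circle_primitive fd' mrho.
have := circle_mean fd' (fc _ (open_box_sub z0r)) mrho dF.
pose u0 := Re (f z0); pose x0 := Re z0; pose y0 := Im z0.
have pi20 : 0 < pi *+ 2 :> R by rewrite mulrn_wgt0// pi_gt0.
(* On the circle of radius [m] about [z0], the term e |z|^2 exceeds its value at [z0] by e m^2 plus
   a trigonometric term. The latter has a periodic primitive, so maximality at [z0] forces the mean
   of [Re f] down to [u0 - e * m ^+ 2], below the value [u0] given by [circle_mean]. *)
have := @derivative_upper_bound R (fun t => F t + 2 * e * m * (x0 * sin t - y0 * cos t))
   (fun t => Re (f (z0 + cexp s t)) + 2 * e * m * (x0 * cos t + y0 * sin t))
   0 (pi *+ 2) (u0 - e * m ^+ 2) (ltW pi20).
rewrite sin2pi cos2pi sin0 cos0 subr0 => H1 H2.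
have e2 : 0 < e * m ^+ 2 * (pi *+ 2) by rewrite !mulr_gt0.
suff : F (pi *+ 2) + 2 * e * m * (x0 * 0 - y0 * 1) - (F 0 + 2 * e * m * (x0 * 0 - y0 * 1))
    <= (u0 - e * m ^+ 2) * (pi *+ 2).
  by move: H2; rewrite -/u0 mulrBl; lra.
apply: H1 => [t tt|t _].
  have dFt := dF t tt.
  by apply: is_derive_eq; first by rewrite /GRing.scale /= ?mulr1; ring.
have /fmax : box r (z0 + cexp s t).
  by apply/open_box_sub/in_box; rewrite addrAC subrr add0r normc_cexp.
have -> : Re (z0 + cexp s t) = x0 + m * cos t by rewrite /x0; case: (z0).
have -> : Im (z0 + cexp s t) = y0 + m * sin t by rewrite /y0; case: (z0).
rewrite -/u0 -/x0 -/y0  => H.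
have cs : m ^+ 2 * (cos t ^+ 2 + sin t ^+ 2) = m ^+ 2 by rewrite cos2Dsin2 mulr1.
have : e * (m ^+ 2 * (cos t ^+ 2 + sin t ^+ 2)) = e * m ^+ 2 by rewrite cs.
move: H; rewrite !sqrrD !mulrDr !exprMn; nra.
Qed.

(** The perturbed function attains its maximum on the compact box, necessarily on the boundary by
    [interior_no_strict_max]; the perturbation is at most [e'] since |z|^2 is at most [2 * r ^+ 2]
    there. *)
Lemma maximum_principle_Re f E (r K : R) : 0 < r ->
  (forall z, box r z -> {for z, continuous f}) ->
  (forall z, open_box r z -> z \notin E -> differentiable f z) ->
  (forall z, box r z -> ~~ open_box r z -> Re (f z) <= K) ->
  forall z, box r z -> Re (f z) <= K.
Proof.
move=> r0 fc fd fK z1 z1r; apply/ler_addgt0Pl => e' e'0.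
pose e := e' / (2 * r ^+ 2).
have e0 : 0 < e by rewrite divr_gt0// mulr_gt0// exprn_gt0.
pose w (p : R * R) := Re (f (p.1 +i* p.2)) + e * (p.1 ^+ 2 + p.2 ^+ 2).
pose A : set (R * R) := `[- r, r] `*` `[- r, r].
have boxA x y : box r (x +i* y) <-> A (x, y).
  by rewrite /box /A /= !in_itv /= -!ler_norml; split => [/andP[]|[-> ->]].
have wc : {in A, continuous w}.
  move=> [x y]; rewrite inE => /boxA xy.
  apply: (@continuousD _ _ _ (fun p : R * R => Re (f (p.1 +i* p.2)))
     (fun p : R * R => e * (p.1 ^+ 2 + p.2 ^+ 2))).
    apply/cvgrPdist_le => d d0.
    have [d1 d10 fd1] := continuous_normcP (fc _ xy) d0.
    have d20 : 0 < d1 / 2 by rewrite divr_gt0.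
    exists (ball x (d1 / 2), ball y (d1 / 2)); first by split; apply: nbhsx_ballx.
    move=> [x' y'] [/= xx' yy'].
    have : normc ((x' +i* y') - (x +i* y)) < d1.
      apply: (le_lt_trans (normc_le_ReIm _)) => /=.
      by move: xx' yy'; rewrite /ball /= [`|x - _|]distrC [`|y - _|]distrC; lra.
    move=> /fd1; apply: le_trans; rewrite distrC.
    by apply: le_trans (norm_Re_le _); case: (f _) => ? ?; case: (f _).
  apply: continuousM; first exact: cst_continuous.
  apply: continuousD; apply: (continuous_comp _ (@exprn_continuous R 2 _)).
    exact: cvg_fst.
  exact: cvg_snd.
have A0 : A !=set0 by exists (0, 0); apply/boxA; rewrite /box /= normr0 ltW.
have Acomp : compact A by apply: compact_setX; exact: segment_compact.
have [[x0 y0]] := compact_EVT_max A0 Acomp (continuous_in_subspaceT wc).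
rewrite inE => /boxA xy0 wmax.
have {}wmax z : box r z -> Re (f z) + e * (Re z ^+ 2 + Im z ^+ 2) <= w (x0, y0).
  by case: z => x y /boxA xyA; apply: (wmax (x, y)); rewrite inE.
have inb : ~~ open_box r (x0 +i* y0).
  by apply/negP => ob; exact: (interior_no_strict_max e0 ob fc fd wmax).
have w0 : w (x0, y0) <= K + e'.
  rewrite /w /=; apply: lerD; first exact: fK.
  case/andP: xy0 => /= x0r y0r.
  have X : x0 ^+ 2 <= r ^+ 2 by rewrite -real_normK ?num_real// lerXn2r// nnegrE// ltW.
  have Y : y0 ^+ 2 <= r ^+ 2 by rewrite -real_normK ?num_real// lerXn2r// nnegrE// ltW.
  have <- : e * (2 * r ^+ 2) = e' by rewrite /e divfK// mulf_neq0// expf_neq0// gt_eqF.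
  by apply: ler_wpM2l; [exact: ltW|lra].
rewrite addrC; apply: le_trans w0; apply: le_trans (wmax _ z1r).
by rewrite lerDl mulr_ge0 ?addr_ge0 ?sqr_ge0// ltW.
Qed.

(** Multiplication by a unit [c] that makes the value at [z1] a positive real reduces the modulus to
    the real part. *)
Lemma maximum_principle f E (r K : R) : 0 < r ->
  (forall z, box r z -> {for z, continuous f}) ->
  (forall z, open_box r z -> z \notin E -> differentiable f z) ->
  (forall z, box r z -> ~~ open_box r z -> normc (f z) <= K) ->
  forall z, box r z -> normc (f z) <= K.
Proof.
move=> r0 fc fd fK z1 z1r.
have [f0|fn0] := eqVneq (f z1) 0.
  rewrite f0 normc0; apply: le_trans (normc_ge0 _) (fK (r%:C) _ _).
    by rewrite /box /= normr0 gtr0_norm// lexx ltW.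
  by rewrite /open_box /= gtr0_norm// ltxx.
have n0 : normc (f z1) != 0 by rewrite normc_eq0.
pose c : CC R := (f z1)^-1 * (normc (f z1))%:C.
have nc : normc c = 1 by rewrite normcM normcV normc_real ger0_norm ?normc_ge0// mulVf.
have -> : normc (f z1) = Re (c * f z1) by rewrite /c mulrAC mulVf// mul1r.
clearbody c; have := @maximum_principle_Re (fun z => c * f z) E r K r0.
move=> /(_ _ _ _ z1 z1r); apply=> [z zr|z zr zE|z zr zb].
- exact: (cvgM (cvg_cst c) (fc z zr)).
- exact: (differentiableM (differentiable_cst c z) (fd z zr zE)).
- apply: (le_trans (ler_norm _)); apply: (le_trans (norm_Re_le _)).
  by rewrite normcM nc mul1r; apply: fK.
Qed.

End MaximumPrinciple.

(** * Divided differences and slopes at a puncture *)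

Section DividedDifference.
Variable R : realType.
Implicit Types (m q : CC R -> CC R) (z v w : CC R) (E : seq (CC R)).

Lemma half_open_box (r : R) v : 0 < r -> normc v <= r / 2 -> open_box r v.
Proof.
move=> r0 vr; have h1 := norm_Re_le v; have h2 := norm_Im_le v.
by apply/andP; split; lra.
Qed.

Lemma near_neq z v : z != v -> \forall w \near z, w != v.
Proof.
move=> zv; apply/nbhs_normcP; exists (normc (z - v)).
  by rewrite lt_def normc_ge0 normc_eq0 subr_eq0 zv.
move=> w; apply: contraTneq => ->; rewrite -leNgt -normcN opprB; exact: lexx.
Qed.

(** Giving the quotient the derivative of [m] as value at [v] makes it continuous there, so [v] just
    joins the exceptional set. On the boundary of the box the denominator is at least [r / 2] and
    the numerator at most [2 * K]; the maximum principle carries the bound inside. *)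
Lemma divided_difference m E (r K : R) v : 0 < r -> normc v <= r / 2 -> v \notin E ->
  (forall z, box r z -> {for z, continuous m}) ->
  (forall z, open_box r z -> z \notin E -> differentiable m z) ->
  (forall z, box r z -> normc (m z) <= K) ->
  exists q, [/\ forall z, z != v -> q z = (m z - m v) / (z - v),
    forall z, box r z -> {for z, continuous q},
    forall z, open_box r z -> z \notin v :: E -> differentiable q z &
    forall z, box r z -> normc (q z) <= 4 / r * K].
Proof.
move=> r0 vr vE mc md mK.
have vob := half_open_box r0 vr; have vb := open_box_sub vob.
have [D DP] := differentiable_normc_expansion (md v vob vE).
pose q z := if z == v then D else (m z - m v) / (z - v).
have qE z : z != v -> q z = (m z - m v) / (z - v) by rewrite /q => /negbTE ->.
have near_q z : z != v -> \forall w \near z, (m w - m v) / (w - v) = q w.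
  by move=> /near_neq; apply: filterS => w /qE ->.
have qc z : box r z -> {for z, continuous q}.
  move=> zb; have [-> |zv] := eqVneq z v.
    apply/(@cvgrPdist_le _ _ _ _ (nbhs_filter v)) => e /ltC_gt0[e' e'0 ->].
    have [d d0 dP] := DP e' e'0.
    apply/nbhs_normcP; exists d => // w wd.
    rewrite {1}/q eqxx; have [->|wv] := eqVneq w v.
      by rewrite /q eqxx subrr normr0 ltW// ltcR.
    have wv0 : w - v != 0 by rewrite subr_eq0.
    rewrite qE// distrC normC_normc lecR.
    have := dP (w - v) wd; rewrite [v + _]addrC subrK.
    have -> : m w - m v - D * (w - v) = ((m w - m v) / (w - v) - D) * (w - v).
      by rewrite mulrBl divfK.
    by rewrite normcM ler_pM2r// lt_def normc_ge0 normc_eq0 wv0.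
  have zv0 : z - v != 0 by rewrite subr_eq0.
  rewrite /prop_for /continuous_at qE//.
  apply: cvg_trans (near_eq_cvg (near_q z zv)) _.
  apply: cvgM.
    by apply: cvgB; [exact: mc|exact: cvg_cst].
  by apply: cvgV => //; apply: cvgB; [exact: cvg_id|exact: cvg_cst].
have qd z : open_box r z -> z \notin v :: E -> differentiable q z.
  move=> zb; rewrite inE negb_or => /andP[zv zE].
  have zv0 : z - v != 0 by rewrite subr_eq0.
  apply: differentiable_near_eq (near_q z zv) _.
  have d1 : differentiable (m \- cst (m v)) z.
    by apply: differentiableB; [exact: md|exact: differentiable_cst].
  have d2 : differentiable (fun w => (w - v)^-1) z.
    have idB : differentiable ((id : CC R -> CC R) \- cst v) z.
      by apply: differentiableB; [by []|exact: differentiable_cst].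
    exact: (differentiableV idB).
  exact: (differentiableM d1 d2).
exists q; split => //.
apply: (maximum_principle r0 qc qd) => z zb zob.
have rz := box_boundary zb zob.
have rzv : r / 2 <= normc (z - v).
  by have := normc_triangle (z - v) v; rewrite subrK; lra.
have zv : z != v.
  by rewrite -subr_eq0 -normc_eq0 gt_eqF//; lra.
rewrite qE// normcM normcV.
have K0 : 0 <= K := le_trans (normc_ge0 _) (mK _ vb).
have mm : normc (m z - m v) <= 2 * K.
  apply: (le_trans (normc_triangle _ _)); rewrite [normc (- _)]normcN.
  by have := mK z zb; have := mK v vb; lra.
rewrite ler_pdivrMr; last by lra.
apply: (le_trans mm).
have -> : 2 * K = 4 / r * K * (r / 2) by field; rewrite gt_eqF.
by apply: ler_wpM2l => //; rewrite mulr_ge0// divr_ge0// ltW.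
Qed.

(* The divided difference of [m] at the nodes 0, w, v is the quotient of the
   difference of the two slopes by [w - v]. *)
Lemma slope_lipschitz m (r K : R) : 0 < r ->
  (forall z, box r z -> {for z, continuous m}) ->
  (forall z, open_box r z -> z != 0 -> differentiable m z) ->
  (forall z, box r z -> normc (m z) <= K) ->
  forall w v, normc w <= r / 2 -> normc v <= r / 2 -> w != 0 -> v != 0 ->
  normc ((m w - m 0) / w - (m v - m 0) / v) <= 4 / r * (4 / r * K) * normc (w - v).
Proof.
move=> r0 mc md mK w v wr vr w0 v0.
have [->|wv] := eqVneq w v; first by rewrite !subrr normc0 mulr0.
have md0 z : open_box r z -> z \notin [:: 0] -> differentiable m z by rewrite inE; exact: md.
have [|q [qE qc qd qK]] := divided_difference r0 wr _ mc md0 mK; first by rewrite inE.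
(* The bound on [q2] holds on the whole box, in particular at the exceptional point 0. *)
have [|q2 [q2E _ _ q2K]] := divided_difference r0 vr _ qc qd qK.
  by rewrite !inE negb_or eq_sym wv v0.
have zb : box r 0 by rewrite /box /= normr0 ltW.
have := q2K 0 zb; rewrite q2E 1?eq_sym// !qE 1?eq_sym//.
have -> : ((m 0 - m w) / (0 - w) - (m v - m w) / (v - w)) / (0 - v) =
   ((m w - m 0) / w - (m v - m 0) / v) / (w - v).
  by field; rewrite !subr_eq0 w0 v0 wv eq_sym wv.
by rewrite normcM normcV ler_pdivrMr// lt_def normc_ge0 normc_eq0 subr_eq0 wv.
Qed.

End DividedDifference.

(** * Quotient by the standard fold *)

Section Rows.
Variables (R : realType) (n : nat).
Local Notation C := (CC R).
Local Notation V := (Cn R n.+1).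
Implicit Types (x y : V) (z : C).

Definition near_row (d : R) x y := forall j, normc (y 0 j - x 0 j) < d.

Lemma near_rowP x (P : set V) :
  nbhs x P <-> exists2 d : R, 0 < d & forall y, near_row d x y -> P y.
Proof.
split=> [/nbhs_ballP[_ /= /ltC_gt0[d d0 ->] dP]|[d d0 dP]].
  exists d => // y xy; apply: dP; split; first by rewrite ltcR.
  by move=> i j; rewrite ord1 /ball /= distrC normC_normc ltcR; exact: xy.
apply/nbhs_ballP; exists d%:C; first by rewrite /= ltcR.
move=> y [_ xy]; apply: dP => j; have := xy 0 j.
by rewrite /ball /= distrC normC_normc ltcR.
Qed.

Lemma continuous_rowP (f : V -> C) x : {for x, continuous f} <->
  forall e : R, 0 < e -> exists2 d : R, 0 < d &
    forall y, near_row d x y -> normc (f y - f x) <= e.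
Proof.
split=> [/(@cvgrPdist_le _ _ _ _ (nbhs_filter x)) fx e e0|fx].
  have /fx/near_rowP[d d0 dP] : 0 < e%:C :> C by rewrite ltcR.
  by exists d => // y /dP; rewrite distrC normC_normc lecR.
apply/(@cvgrPdist_le _ _ _ _ (nbhs_filter x)) => _ /ltC_gt0[e e0 ->].
have [d d0 dP] := fx e e0; apply/near_rowP; exists d => // y /dP.
by rewrite distrC normC_normc lecR.
Qed.

Lemma coord_le_norm x j : `|x 0 j| <= `|x|.
Proof.
rewrite real_leNgt ?normr_real//; apply/negP => xj.
have : ball (0 : V) `|x 0 j| x by rewrite mx_norm_ball /ball_ /= sub0r normrN.
by case=> _ /(_ 0 j); rewrite /ball /= mxE sub0r normrN ltxx.
Qed.

Definition set0th x z : V := \row_j (if (j == 0 :> nat)%N then z else x 0 j).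

Lemma set0th0 x z : set0th x z 0 0 = z. Proof. by rewrite mxE. Qed.

Lemma set0th_set0th x z z' : set0th (set0th x z) z' = set0th x z'.
Proof. by apply/rowP => j; rewrite !mxE; case: ifPn => // /negbTE ->. Qed.

Lemma set0th_id x : set0th x (x 0 0) = x.
Proof. by apply/rowP => j; rewrite mxE; case: ifP => // /eqP j0; congr (x _ _); apply/val_inj. Qed.

Lemma set0thE x z : set0th x z = x + (z - x 0 0) *: delta_mx 0 0.
Proof.
apply/rowP => j; rewrite !mxE eqxx /=; case: ifP => [j0|j0].
  have -> : j = 0 by apply/val_inj/eqP.
  by rewrite eqxx mulr1 addrC subrK.
by rewrite (_ : (j == 0) = false) ?mulr0 ?addr0.
Qed.

Lemma near_row_set0th d x y z : near_row d x y -> normc (z - x 0 0) < d -> near_row d x (set0th y z).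
Proof.
move=> xy zd j; rewrite mxE; case: ifP => // /eqP j0.
by rewrite (_ : j = 0)//; apply/val_inj.
Qed.

Lemma differentiable_set0th (f : V -> C) x : differentiable f x ->
  differentiable (fun y => set0th y (f y)) x.
Proof.
move=> df; rewrite (_ : (fun y => _) =
    id + fun y => (f \- (fun N : V => N 0 0)) y *: delta_mx 0 0); last first.
  by apply/funext => y; rewrite set0thE.
apply: differentiableD; first by [].
apply: differentiableZl; apply: differentiableB => //; exact: differentiable_coord.
Qed.

Lemma differentiable_set0th_slice y z : differentiable (set0th y) z.
Proof.
rewrite (_ : set0th y = cst y + fun z : C => ((id : C -> C) \- cst (y 0 0)) z *: delta_mx 0 0); last first.
  by apply/funext => w; rewrite set0thE.
apply: differentiableD; first exact: differentiable_cst.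
by apply: differentiableZl; apply: differentiableB; [by []|exact: differentiable_cst].
Qed.

(** The factor vanishing at [x] absorbs the variation of [phi], and the differential is [phi x]
    times that of the coordinate. Holomorphy of roots and of fold quotients is thereby reduced to
    continuity of a cofactor. *)
Lemma differentiable_coord_mul (phi : V -> C) x : {for x, continuous phi} ->
  differentiable (fun y => (y 0 0 - x 0 0) * phi y) x.
Proof.
move=> phic.
have [L LE] : exists L : {linear V -> C}, L = (fun y => phi x * y 0 0) :> (V -> C).
  have @f : {linear V -> C}.
    by exists (fun y : V => y 0 0); do 2![eexists]; do ?[constructor];
      rewrite ?mxE// => ? *; rewrite ?mxE//; move=> ?; rewrite !mxE.
  by exists (phi x \*: f).
have Lc : continuous L.
  by rewrite LE => y; exact: (cvgM (cvg_cst (phi x)) (@coord_continuous C 1 n.+1 0 0 y)).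
apply: (differentiable_of_expansion Lc) => e e0.
move/(@cvgrPdist_le _ _ _ _ (nbhs_filter x)) : phic => /(_ e e0).
apply: filterS => y xy; rewrite LE subrr mul0r subr0 !mxE [_ * (_ - _)]mulrC -mulrBr normrM mulrC.
apply: ler_pM => //; first by rewrite distrC.
by have := coord_le_norm (y - x) 0; rewrite !mxE.
Qed.

End Rows.

(** * Roots of complex numbers and limits of slopes *)

Section Roots.
Variable R : realType.
Local Notation C := (CC R).
Implicit Types (x w z : C).

Lemma normcX z k : normc (z ^+ k) = normc z ^+ k.
Proof. by elim: k => [|k IH]; rewrite ?expr0 ?normc1// !exprS normcM IH. Qed.

Lemma ex_min_normc (s : seq C) x : s != [::] ->
  exists2 z, z \in s & forall z', z' \in s -> normc (x - z) <= normc (x - z').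
Proof.
elim: s => // a s IH _; have [->|/IH[z zs zmin]] := eqVneq s [::].
  by exists a; rewrite ?inE// => z'; rewrite inE => /eqP ->.
have [az|za] := leP (normc (x - a)) (normc (x - z)).
  exists a; first exact: mem_head.
  by move=> z'; rewrite inE => /orP[/eqP ->//|/zmin]; exact: le_trans.
exists z; first by rewrite inE zs orbT.
by move=> z'; rewrite inE => /orP[/eqP ->|/zmin//]; exact: ltW.
Qed.

(* The factorization [x ^ k - w = \prod (x - z)] over the k-th roots z of w
   bounds the distance from x to the closest root. *)
Lemma ex_near_root k x w : (0 < k)%N ->
  exists2 z, z ^+ k = w & normc (z - x) ^+ k <= normc (w - x ^+ k).
Proof.
move=> k0; have [s sE] := closed_field_poly_normal ('X^k - w%:P).
rewrite lead_coefXnsubC// scale1r in sE.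
have sz : size s = k.
  by have := size_XnsubC w k0; rewrite sE size_prod_XsubC => -[].
have [|z zs zmin] := @ex_min_normc s x.
  by rewrite -size_eq0 sz -lt0n.
exists z.
  have : root ('X^k - w%:P) z by rewrite sE root_prod_XsubC.
  by rewrite /root !hornerE subr_eq0 => /eqP.
have <- : normc (x ^+ k - w) = normc (w - x ^+ k) by rewrite -normcN opprB.
have -> : x ^+ k - w = ('X^k - w%:P).[x] by rewrite !hornerE.
rewrite sE horner_prod -normcN opprB -sz.
elim: s zmin {sE sz zs} => [|a s IH] zmin; first by rewrite big_nil expr0 normc1.
rewrite big_cons normcM exprS !hornerE; apply: ler_pM => //.
- exact: normc_ge0.
- by rewrite exprn_ge0// normc_ge0.
- by apply: zmin; rewrite inE eqxx.
- by apply: IH => z' z's; apply: zmin; rewrite inE z's orbT.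
Qed.

Lemma near_root_continuous k x (s : C -> C) : (0 < k)%N ->
  (forall w, normc (s w - x) ^+ k <= normc (w - x ^+ k)) ->
  {for x ^+ k, continuous s} /\ s (x ^+ k) = x.
Proof.
move=> k0 sP.
have sx : s (x ^+ k) = x.
  apply/eqP; rewrite -subr_eq0 -normc_eq0; have := sP (x ^+ k).
  rewrite subrr normc0 => H; have := exprn_ge0 k (normc_ge0 (s (x ^+ k) - x)).
  by move=> H'; have /eqP := le_anti (introT andP (conj H H')); rewrite expf_eq0 => /andP[].
split => //; apply/(@cvgrPdist_le _ _ _ _ (nbhs_filter _)) => _ /ltC_gt0[e e0 ->].
apply/nbhs_normcP; exists (e ^+ k); first by rewrite exprn_gt0.
move=> w wk; rewrite sx distrC normC_normc lecR.
rewrite -(@ler_pXn2r _ k) ?nnegrE ?normc_ge0//; last exact: ltW.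
exact: le_trans (sP w) (ltW wk).
Qed.

(** A Lipschitz function on a punctured disc has a limit at the centre. It is found on the positive
    real ray, as a supremum for each of the real and imaginary parts, at a cost of [2 * B]; passing
    from [w] to its modulus, at distance at most twice that modulus, costs another [2 * B]. *)
Lemma slope_limit (h : C -> C) (B rho : R) : 0 < rho -> 0 <= B ->
  (forall w v, normc w <= rho -> normc v <= rho -> w != 0 -> v != 0 ->
    normc (h w - h v) <= B * normc (w - v)) ->
  exists c, forall w, normc w <= rho -> w != 0 -> normc (h w - c) <= 4 * B * normc w.
Proof.
move=> rho0 B0 hB.
have limR (a : R -> R) : (forall s t, 0 < s <= rho -> 0 < t <= rho ->
    `|a s - a t| <= B * `|s - t|) ->
    exists A, forall t, 0 < t <= rho -> `|a t - A| <= B * t.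
  move=> aB; pose S := [set x | exists2 t, 0 < t <= rho & x = a t - B * t].
  have aS s t : 0 < s <= rho -> 0 < t <= rho -> a s - B * s <= a t + B * t.
    move=> s0 t0; have := aB s t s0 t0; move: (s0) (t0) => /andP[s1 _] /andP[t1 _].
    have : `|s - t| <= s + t by rewrite ler_norml; apply/andP; split; lra.
    move=> /(ler_wpM2l B0) h1 /le_trans /(_ h1); rewrite ler_norml => /andP[_]; lra.
  exists (sup S) => t t0; rewrite ler_norml; apply/andP; split.
    have : sup S <= a t + B * t.
      apply: ge_sup; first by exists (a t - B * t), t.
      by move=> _ [s s0 ->]; exact: aS.
    lra.
  have : a t - B * t <= sup S.
    apply: ub_le_sup; last by exists t.
    by exists (a t + B * t) => _ [s s0 ->]; exact: aS.
  lra.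
have hR s t : 0 < s <= rho -> 0 < t <= rho ->
    normc (h s%:C - h t%:C) <= B * `|s - t|.
  move=> /andP[s0 s1] /andP[t0 t1].
  have -> : `|s - t| = normc (s%:C - t%:C) by rewrite -rmorphB normc_real.
  by apply: hB; rewrite ?normc_real ?gtr0_norm// eq_complex /= eqxx andbT gt_eqF.
have [|A1 A1P] := limR (fun t => Re (h t%:C)).
  move=> s t s0 t0; apply: le_trans (hR s t s0 t0).
  by apply: le_trans (norm_Re_le _); case: (h _) => ? ?; case: (h _).
have [|A2 A2P] := limR (fun t => Im (h t%:C)).
  move=> s t s0 t0; apply: le_trans (hR s t s0 t0).
  by apply: le_trans (norm_Im_le _); case: (h _) => ? ?; case: (h _).
exists (A1 +i* A2) => w wrho w0.
have nw0 : 0 < normc w by rewrite lt_def normc_ge0 normc_eq0 w0.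
have nwr : 0 < normc w <= rho by rewrite nw0 wrho.
have H : normc (h (normc w)%:C - (A1 +i* A2)) <= 2 * B * normc w.
  apply: (le_trans (normc_le_ReIm _)).
  have := A1P _ nwr; have := A2P _ nwr; case: (h _) => a b /=; lra.
have -> : h w - (A1 +i* A2) = (h w - h (normc w)%:C) + (h (normc w)%:C - (A1 +i* A2)).
  by rewrite addrA subrK.
apply: (le_trans (normc_triangle _ _)).
have : normc (h w - h (normc w)%:C) <= B * normc (w - (normc w)%:C).
  apply: hB => //; rewrite ?normc_real ?gtr0_norm//.
  by rewrite eq_complex /= eqxx andbT gt_eqF.
have : B * normc (w - (normc w)%:C) <= B * (2 * normc w).
  apply: ler_wpM2l => //; apply: (le_trans (normc_triangle _ _)).
  by rewrite [normc (- _)]normcN normc_real gtr0_norm//; lra.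
lra.
Qed.

End Roots.

Lemma continuous_expM_cst (R : realType) (T : topologicalType) (f : T -> CC R) (x : T) m (c : CC R) :
  f y @[y --> x] --> f x -> f y ^+ m * c @[y --> x] --> f x ^+ m * c.
Proof.
move=> fc; elim: m => [|m IH]; first exact: (@cst_continuous T (CC R) (1 * c) x).
under eq_fun do rewrite exprS -mulrA.
by rewrite exprS -mulrA; exact: (cvgM fc IH).
Qed.

(** * Holomorphy of the quotient by the fold *)

Section FoldQuotient.
Variables (R : realType) (n k : nat).
Local Notation C := (CC R).
Local Notation V := (Cn R n.+1).
Variables (G : V -> C) (d K : R).
Hypothesis k_gt0 : (0 < k)%N.
Hypothesis d_gt0 : 0 < d.
Hypothesis G_diff : forall x, near_row d 0 x -> differentiable G x.
Hypothesis G_bound : forall x, near_row d 0 x -> normc (G x) <= K.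
Hypothesis G_inv : forall x (w : C), near_row d 0 x -> w ^+ k = 1 ->
  G (set0th x (w * x 0 0)) = G x.

(* [k.-root] is not continuous, but by [G_inv] any other choice of the k-th root
   gives the same value. *)
Definition fold_quotient (y : V) : C := G (set0th y (k.-root (y 0 0))).
Local Notation M := fold_quotient.
(** The bound [d ^+ k] keeps the k-th roots of coordinate 0 below [d], and the bound [d] controls
    the other coordinates. *)
Let d' := Num.min d (d ^+ k).

Let d'_gt0 : 0 < d'. Proof. by rewrite lt_min d_gt0 exprn_gt0. Qed.

Let root_near (y : V) (s : C) : near_row d' 0 y -> s ^+ k = y 0 0 -> near_row d 0 (set0th y s).
Proof.
move=> yd sk; apply: near_row_set0th.
  by move=> j; apply: lt_le_trans (yd j) _; rewrite ge_min lexx.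
rewrite mxE subr0 -(@ltr_pXn2r _ k) ?nnegrE ?normc_ge0//; last exact: ltW.
rewrite -normcX sk; have := yd 0; rewrite mxE subr0 => /lt_le_trans; apply.
by rewrite ge_min lexx orbT.
Qed.

Lemma fold_quotientE y s : near_row d' 0 y -> s ^+ k = y 0 0 -> M y = G (set0th y s).
Proof.
move=> yd sk; rewrite /M; have [y0|y0] := eqVneq (y 0 0) 0.
  move/eqP: sk; rewrite y0 expf_eq0 k_gt0 => /eqP ->.
  have /eqP := rootCK k_gt0 (0 : C); rewrite expf_eq0 k_gt0 => /eqP /= ->.
  by [].
have s0 : s != 0 by apply: contraNneq y0 => s0; rewrite -sk s0 expr0n gtn_eqF.
have := G_inv (root_near yd sk) (_ : (k.-root (y 0 0) / s) ^+ k = 1).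
rewrite set0th0 divfK// set0th_set0th; apply.
by rewrite expr_div_n rootCK// sk divff.
Qed.

Let near_d' (y0 : V) : near_row d' 0 y0 -> \forall y \near y0, near_row d' 0 y.
Proof.
move=> y0d; apply/near_rowP.
have [e e0 eP] : exists2 e : R, 0 < e & forall j, normc (y0 0 j) + e <= d'.
  have : forall s : seq 'I_n.+1, exists2 e : R, 0 < e & forall j, j \in s -> normc (y0 0 j) + e <= d'.
    elim=> [|j s [e e0 eP]]; first by exists 1.
    exists (Num.min e (d' - normc (y0 0 j))).
      by rewrite lt_min e0 subr_gt0; have := y0d j; rewrite mxE subr0.
    move=> i; rewrite inE => /orP[/eqP ->|/eP].
      have : Num.min e (d' - normc (y0 0 j)) <= d' - normc (y0 0 j) by rewrite ge_min lexx orbT.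
      lra.
    have : Num.min e (d' - normc (y0 0 j)) <= e by rewrite ge_min lexx.
    lra.
  by move=> /(_ (enum 'I_n.+1))[e e0 eP]; exists e => // j; apply: eP; rewrite mem_enum.
exists e => // y yy0 j; rewrite mxE subr0.
have := yy0 j; have := eP j; have := normc_triangle (y 0 j - y0 0 j) (y0 0 j).
by rewrite subrK; lra.
Qed.

(* Away from the branch locus, [M] is [G] composed with a local branch of the root. *)
Let differentiable_off0 (y0 : V) : near_row d' 0 y0 -> y0 0 0 != 0 -> differentiable M y0.
Proof.
move=> y0d y00; have [x0 x0k] : exists x0 : C, x0 ^+ k = y0 0 0.
  by exists (k.-root (y0 0 0)); exact: rootCK.
have x00 : x0 != 0 by apply: contraNneq y00 => x00; rewrite -x0k x00 expr0n gtn_eqF.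
have /choice[s sP] : forall w, exists s : C, s ^+ k = w /\ normc (s - x0) ^+ k <= normc (w - x0 ^+ k).
  by move=> w; have [z z1 z2] := ex_near_root x0 w k_gt0; exists z.
have [sc sx] := near_root_continuous k_gt0 (fun w => (sP w).2).
rewrite x0k in sc sx.
(* [S] is the cofactor of [s - x0] in the difference of k-th powers, with value [k * x0 ^+ k.-1] at
   [y0], which is nonzero. Hence [s] is [x0] plus the increment of coordinate 0 divided by [S], and
   continuity of [s] at one point yields its differentiability there. *)
pose S (y : V) : C := \sum_(i < k) s (y 0 0) ^+ (k.-1 - i) * x0 ^+ i.
have sc' : (fun y : V => s (y 0 0)) @ y0 --> s (y0 0 0).
  exact: (continuous_comp (@coord_continuous C 1 n.+1 0 0 y0) sc).
have Sc : S @ y0 --> S y0.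
  rewrite /S; elim: (index_enum _) => [|i l IH].
    by under eq_fun do rewrite big_nil; rewrite big_nil; exact: (@cst_continuous V C 0 y0).
  under eq_fun do rewrite big_cons; rewrite big_cons.
  exact: (cvgD (continuous_expM_cst sc') IH).
have S0 : S y0 != 0.
  rewrite /S sx.
  rewrite (eq_bigr (fun _ => x0 ^+ k.-1)); last first.
    by move=> i _; rewrite -exprD subnK// -ltnS prednK.
  rewrite sumr_const card_ord -mulr_natl mulf_neq0// ?expf_neq0//.
  by rewrite pnatr_eq0 -lt0n.
have dS : differentiable (fun y : V => (y 0 0 - y0 0 0) * (S y)^-1) y0.
  exact: (differentiable_coord_mul (cvgV S0 Sc)).
have ds : differentiable (fun y : V => s (y 0 0)) y0.
  have near_S : \forall y \near y0, S y != 0 by exact: (cvgr_neq0 _ Sc S0).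
  apply: (@differentiable_near_eq _ _ _ (cst x0 + (fun y : V => (y 0 0 - y0 0 0) * (S y)^-1))).
    move: near_S; apply: filterS => y Sy0.
    rewrite /= fctE.
    have := subrXX (s (y 0 0)) x0 k; rewrite (sP _).1 x0k -/(S y) => ->.
    by rewrite mulfK// addrC subrK.
  by apply: differentiableD => //; exact: differentiable_cst.
apply: (@differentiable_near_eq _ _ _ (G \o (fun y => set0th y (s (y 0 0))))).
  move: (near_d' y0d); apply: filterS => y yd.
  by rewrite (fold_quotientE yd (sP (y 0 0)).1).
apply: differentiable_comp; first exact: differentiable_set0th.
by apply: G_diff; apply: root_near => //; exact: (sP _).1.
Qed.

(** Points of [box r] have modulus at most [2 * r], which is less than [d']. *)
Let r := d' / 4.
Let r_gt0 : 0 < r. Proof. by rewrite divr_gt0. Qed.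

Let box_near (y : V) z : near_row d' 0 y -> box r z -> near_row d' 0 (set0th y z).
Proof.
move=> yd /andP[z1 z2]; apply: near_row_set0th => //; rewrite mxE subr0.
have := normc_le_ReIm z; rewrite /r in z1 z2; move: d'_gt0; lra.
Qed.

Let M_set0th0 (y : V) : near_row d' 0 y -> M (set0th y 0) = G (set0th y 0).
Proof.
move=> yd; rewrite (@fold_quotientE _ 0) ?set0th_set0th//; last by rewrite set0th0 expr0n gtn_eqF.
by apply: box_near => //; rewrite /box /= normr0 ltW.
Qed.

Let slice_differentiable (y : V) z : near_row d' 0 y -> box r z -> z != 0 ->
  differentiable (fun z => M (set0th y z)) z.
Proof.
move=> yd zr z0; apply: (@differentiable_comp _ _ _ _ (set0th y) M).
  exact: differentiable_set0th_slice.
by apply: differentiable_off0; [exact: box_near|rewrite set0th0].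
Qed.

Let slice_continuous (y : V) z : near_row d' 0 y -> box r z ->
  {for z, continuous (fun z => M (set0th y z))}.
Proof.
move=> yd zr; have [->|z0] := eqVneq z 0; last first.
  exact: differentiable_continuous (slice_differentiable yd zr z0).
apply/(@cvgrPdist_le _ _ _ _ (nbhs_filter _)) => _ /ltC_gt0[e e0 ->].
have b0 : box r (0 : C) by rewrite /box /= normr0 ltW.
have y0d : near_row d 0 (set0th y 0).
  by move=> j; apply: lt_le_trans (box_near yd b0 j) _; rewrite ge_min lexx.
have /continuous_rowP Gc := differentiable_continuous (G_diff y0d).
have [d1 d10 dP] := Gc e e0.
apply/nbhs_normcP; exists (d1 ^+ k); first by rewrite exprn_gt0.
move=> w; rewrite subr0 => wk; rewrite M_set0th0// distrC normC_normc lecR.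
rewrite /fold_quotient set0th_set0th set0th0; apply: dP => j.
rewrite !mxE; case: ifP => _; last by rewrite subrr normc0.
rewrite subr0 -(@ltr_pXn2r _ k) ?nnegrE ?normc_ge0//; last exact: ltW.
by rewrite -normcX rootCK.
Qed.

Let slice_bound (y : V) z : near_row d' 0 y -> box r z -> normc (M (set0th y z)) <= K.
Proof.
move=> yd zr; apply: G_bound; apply: root_near; first exact: box_near.
by rewrite rootCK// set0th0.
Qed.

(** At the branch locus, [M y] is its value on the locus plus [y 0 0] times the slope [phi y], and
    only continuity of [phi] at [y0] remains. It follows from the Lipschitz bound [B] on slopes,
    which is the same for all slices. *)
Lemma fold_quotient_differentiable (y0 : V) : near_row d' 0 y0 -> differentiable M y0.
Proof.
move=> y0d; have [y00|y00] := eqVneq (y0 0 0) 0; last exact: differentiable_off0.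
pose h y z := (M (set0th y z) - M (set0th y 0)) / z.
pose B := 4 / r * (4 / r * K).
have K0 : 0 <= K.
  apply: le_trans (normc_ge0 _) (@G_bound 0 _) => j.
  by rewrite subrr normc0.
have B0 : 0 <= B.
  have r4 : 0 <= 4 / r by rewrite divr_ge0// ltW.
  by rewrite mulr_ge0// mulr_ge0.
have hB y w v : near_row d' 0 y -> normc w <= r / 2 -> normc v <= r / 2 -> w != 0 -> v != 0 ->
    normc (h y w - h y v) <= B * normc (w - v).
  move=> yd; apply: (@slope_lipschitz R (fun z => M (set0th y z)) r K r_gt0).
  - by move=> z; exact: slice_continuous.
  - by move=> z /open_box_sub zr; exact: slice_differentiable.
  - by move=> z; exact: slice_bound.
have r2 : 0 < r / 2 by rewrite divr_gt0.
have [c cP] := slope_limit r2 B0 (fun w v => @hB y0 w v y0d).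
(* The limit slope [c] of the slice through [y0] serves as the value at every point of the branch
   locus; continuity is claimed at [y0] alone. *)
pose phi (y : V) : C := if y 0 0 == 0 then c else h y (y 0 0).
have phic : {for y0, continuous phi}.
  apply/continuous_rowP => e e0.
  (* The slopes are compared through a fixed abscissa [tau]: moving to it in the slice of [y] costs
     [2 * B * tau], passing to the slice of [y0] costs [e / 2], and going to the limit [c] costs
     [4 * B * tau]. *)
  have [tau [tau0 taur taue]] :
      exists tau : R, [/\ 0 < tau, tau <= r / 2 & (6 * B + 1) * tau <= e / 2].
    have B1 : 0 < 2 * (6 * B + 1) by rewrite mulr_gt0// ltr_wpDl// mulr_ge0.
    exists (Num.min (r / 2) (e / (2 * (6 * B + 1)))).
    rewrite lt_min r2 divr_gt0// ge_min lexx; split => //.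
    have : Num.min (r / 2) (e / (2 * (6 * B + 1))) <= e / (2 * (6 * B + 1)).
      by rewrite ge_min lexx orbT.
    rewrite ler_pdivlMr//; lra.
  have tau_n : normc tau%:C = tau by rewrite normc_real gtr0_norm.
  have tauC0 : tau%:C != 0 :> C by rewrite eq_complex /= eqxx andbT gt_eqF.
  have taub : box r (tau%:C : C) by apply/open_box_sub/half_open_box => //; rewrite tau_n.
  have hc : {for y0, continuous (fun y => h y tau%:C)}.
    have setc z : {for y0, continuous (fun y : V => set0th y z)}.
      exact: (differentiable_continuous (differentiable_set0th (differentiable_cst z y0))).
    have Mtau : (fun y : V => M (set0th y tau%:C)) @ y0 --> M (set0th y0 tau%:C).
      apply: (continuous_comp (setc _)); apply: differentiable_continuous.
      by apply: differentiable_off0; [exact: box_near|rewrite set0th0].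
    have b0 : box r (0 : C) by rewrite /box /= normr0 ltW.
    have M0 : (fun y : V => M (set0th y 0)) @ y0 --> M (set0th y0 0).
      rewrite (M_set0th0 y0d).
      have G0 : (fun y : V => G (set0th y 0)) @ y0 --> G (set0th y0 0).
        apply: (continuous_comp (setc _)); apply: differentiable_continuous.
        by apply: G_diff => j; apply: lt_le_trans (box_near y0d b0 j) _; rewrite ge_min lexx.
      apply: cvg_trans (near_eq_cvg _) G0.
      by move: (near_d' y0d); apply: filterS => y yd; rewrite /= (M_set0th0 yd).
    exact: (cvgM (cvgB Mtau M0) (@cst_continuous V C (tau%:C)^-1 y0)).
  have e20 : 0 < e / 2 by rewrite divr_gt0.
  have /continuous_rowP/(_ _ e20)[d1 d10 hP] := hc.
  have /near_rowP[d2 d20 d2P] := near_d' y0d.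
  exists (Num.min d1 (Num.min d2 tau)); first by rewrite !lt_min d10 d20 tau0.
  move=> y yy0; rewrite /phi y00 eqxx.
  have yd : near_row d' 0 y.
    by apply: d2P => j; apply: lt_le_trans (yy0 j) _; rewrite !ge_min lexx !orbT.
  have hy : normc (h y tau%:C - h y0 tau%:C) <= e / 2.
    by apply: hP => j; apply: lt_le_trans (yy0 j) _; rewrite !ge_min lexx.
  have ytau : normc (y 0 0) <= tau.
    rewrite -[y 0 0]subr0 -y00; apply: le_trans (ltW (yy0 0)) _.
    by rewrite !ge_min lexx !orbT.
  case: eqVneq => [_|yn0]; first by rewrite subrr normc0 ltW.
  have -> : h y (y 0 0) - c = (h y (y 0 0) - h y tau%:C) +
      ((h y tau%:C - h y0 tau%:C) + (h y0 tau%:C - c)) by ring.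
  apply: (le_trans (normc_triangle _ _)).
  have H1 := normc_triangle (h y tau%:C - h y0 tau%:C) (h y0 tau%:C - c).
  have H2 : normc (h y0 tau%:C - c) <= 4 * B * tau.
    by have := cP tau%:C; rewrite tau_n => /(_ taur tauC0).
  have H3 : normc (h y (y 0 0) - h y tau%:C) <= B * (2 * tau).
    apply: (le_trans (hB y _ _ yd _ _ yn0 tauC0)); rewrite ?tau_n//.
      exact: le_trans ytau taur.
    apply: ler_wpM2l => //; apply: (le_trans (normc_triangle _ _)).
    by rewrite [normc (- _)]normcN tau_n; lra.
  by move: tau0; lra.
have dphi := differentiable_coord_mul phic.
apply: (@differentiable_near_eq _ _ _
   ((fun y => G (set0th y 0)) + (fun y : V => (y 0 0 - y0 0 0) * phi y))).
  move: (near_d' y0d); apply: filterS => y yd.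
  rewrite fctE y00 subr0 /phi; case: eqVneq => [yn0|yn0].
    by rewrite yn0 mul0r addr0 -M_set0th0// -{1}yn0 set0th_id.
  by rewrite mulrC divfK// set0th_id M_set0th0// addrC subrK.
apply: differentiableD; last exact: dphi.
apply: (@differentiable_comp _ _ _ _ (fun y => set0th y 0) G).
  exact: (differentiable_set0th (differentiable_cst 0 y0)).
apply: G_diff => j; have b0 : box r (0 : C) by rewrite /box /= normr0 ltW.
by apply: lt_le_trans (box_near y0d b0 j) _; rewrite ge_min lexx.
Qed.

End FoldQuotient.

(** * Symmetries of the standard fold *)

Section FoldSymmetry.
Variables (R : realType) (n k : nat).
Local Notation C := (CC R).
Local Notation V := (Cn R n.+1).
Hypothesis k_gt0 : (0 < k)%N.

Lemma normc_root_of_unity (u : C) : u ^+ k = 1 -> normc u = 1.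
Proof.
move=> uk; apply/eqP; rewrite -(@eqrXn2 _ k) ?normc_ge0//.
by rewrite -normcX uk normc1 expr1n.
Qed.

(** Were the ratio [v] different from 1, its powers would sum to 0 and the k terms [1 - v ^+ i] to
    k. Each of them has modulus at most i |1 - v|, hence less than 1. *)
Lemma root_of_unity_gap (u w : C) : u ^+ k = 1 -> w ^+ k = 1 ->
  normc (w - u) < 1 / k%:R -> w = u.
Proof.
move=> uk wk wu.
have u0 : u != 0 by apply: contra_eqN uk => /eqP ->; rewrite expr0n gtn_eqF// eq_sym oner_eq0.
pose v := w / u; have vk : v ^+ k = 1 by rewrite expr_div_n uk wk divr1.
have [v1|v1] := eqVneq v 1; first by rewrite -[w](divfK u0) -/v v1 mul1r.
have k0 : 0 < k%:R :> R by rewrite ltr0n.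
have nv : normc (1 - v) < 1 / k%:R.
  have -> : 1 - v = (u - w) / u by rewrite mulrBl divff.
  by rewrite normcM normcV (normc_root_of_unity uk) invr1 mulr1 -normcN opprB.
have vi i : normc (1 - v ^+ i) <= i%:R * normc (1 - v).
  elim: i => [|i IH]; first by rewrite expr0 subrr normc0 mul0r.
  have -> : 1 - v ^+ i.+1 = (1 - v ^+ i) + v ^+ i * (1 - v) by rewrite exprSr; ring.
  apply: (le_trans (normc_triangle _ _)).
  by rewrite normcM normcX (normc_root_of_unity vk) expr1n mul1r -natr1 mulrDl mul1r lerD2r.
have sum0 : \sum_(i < k) v ^+ i = 0.
  have /eqP := subrX1 v k; rewrite vk subrr eq_sym mulf_eq0 subr_eq0 (negbTE v1).
  by move=> /eqP.
have sumk : \sum_(i < k) (1 - v ^+ i) = k%:R :> C.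
  by rewrite sumrB sum0 subr0 sumr_const card_ord.
have sum_lt : forall l : seq 'I_k, l != [::] -> normc (\sum_(i <- l) (1 - v ^+ i)) < (size l)%:R.
  elim=> // i l IH _; rewrite big_cons /= -natr1 [ltRHS]addrC.
  have i1 : normc (1 - v ^+ i) < 1.
    apply: (le_lt_trans (vi i)); apply: (@le_lt_trans _ _ (k%:R * normc (1 - v))).
      by apply: ler_wpM2r; [exact: normc_ge0|rewrite ler_nat ltnW].
    by rewrite mulrC -ltr_pdivlMr.
  have [->|/IH l0] := eqVneq l [::]; first by rewrite big_nil !addr0.
  by apply: (le_lt_trans (normc_triangle _ _)); exact: ltrD.
have sizeE : size (index_enum 'I_k) = k by rewrite -[RHS](card_ord k) cardE enumT.
have /sum_lt : index_enum 'I_k != [::] by rewrite -size_eq0 sizeE -lt0n.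
have kC : k%:R = (k%:R : R)%:C :> C by rewrite rmorph_nat.
by rewrite sumk sizeE kC normc_real ger0_norm ?ler0n// ltxx.
Qed.

Lemma row_norm_le (x : V) (c : C) : (forall j, `|x 0 j| <= c) -> `|x| <= c.
Proof.
move=> xc; have c0 : 0 <= c := le_trans (normr_ge0 _) (xc 0).
rewrite real_leNgt ?ger0_real//; apply/negP => cx.
have : ball (0 : V) `|x| x.
  split; first exact: le_lt_trans cx.
  move=> i j; rewrite ord1 /ball /= mxE sub0r normrN; exact: le_lt_trans cx.
by rewrite mx_norm_ball /ball_ /= sub0r normrN ltxx.
Qed.

(* Comparison with the linear part at 0 gives [gamma x = eta x_0] where [x_0]
   dominates the other coordinates; the maximum principle propagates this identity
   along the slices of constant [x_1, ..., x_n]. *)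
Lemma fold_symmetry_linear (gamma : V -> V) :
  holo_germ gamma -> germ_eq (standard_fold k \o gamma) (standard_fold k) ->
  exists2 eta : C, eta ^+ k = 1 & germ_eq gamma (fun x => set0th x (eta * x 0 0)).
Proof.
move=> [gamma0 dgamma] Fgamma.
have [d d0 dP] : exists2 d : R, 0 < d & forall x, near_row d 0 x ->
    differentiable gamma x /\ standard_fold k (gamma x) = standard_fold k x.
  have /near_rowP[d d0 dP] : \forall x \near (0 : V), differentiable gamma x /\
      standard_fold k (gamma x) = standard_fold k x.
    by move: dgamma Fgamma; apply: filterS2.
  by exists d.
have gj x (j : 'I_n.+1) : near_row d 0 x -> j != 0 :> nat -> gamma x 0 j = x 0 j.
  move=> /dP[_ /rowP/(_ j)]; rewrite !mxE => + j0; by rewrite (negbTE j0).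
have g0k x : near_row d 0 x -> gamma x 0 0 ^+ k = x 0 0 ^+ k.
  by move=> /dP[_ /rowP/(_ 0)]; rewrite !mxE.
pose g (x : V) : C := gamma x 0 0.
have dg x : near_row d 0 x -> differentiable g x.
  by move=> /dP[dx _]; exact: (differentiable_comp dx (differentiable_coord (gamma x) 0 0)).
have near00 : near_row d 0 (0 : V) by move=> j; rewrite subrr normc0.
have g00 : g 0 = 0 by rewrite /g gamma0 mxE.
pose L := 'd g (0 : V).
have k0 : 0 < k%:R :> R by rewrite ltr0n.
(* Two ratios within [2 * e] of [lambda] differ by at most [4 * e], less than the gap [1 / k]
   between k-th roots of unity. *)
pose e : R := 1 / (8 * k%:R).
have e0 : 0 < e by rewrite divr_gt0// mulr_gt0.
have e0C : 0 < e%:C :> C by rewrite ltcR.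
have /near_rowP[d1 d10 gL] := differentiable_expansion (dg 0 near00) e0C.
pose r := Num.min d d1 / 4.
have r0 : 0 < r by rewrite divr_gt0// lt_min d0 d10.
have rd (x : V) : near_row (4 * r) 0 x -> near_row d 0 x /\ near_row d1 0 x.
  have -> : 4 * r = Num.min d d1 by rewrite /r mulrC divfK.
  move=> xr; split=> j; apply: (lt_le_trans (xr j)); first by rewrite ge_min lexx.
  by rewrite ge_min lexx orbT.
have {}gL x : near_row (4 * r) 0 x -> `|g x - L x| <= e%:C * `|x|.
  by move=> /rd[_ /gL]; rewrite g00 !subr0.
pose lambda := L (delta_mx 0 0).
(* As [g] vanishes where coordinate 0 does, its linear part is also small at [set0th x 0]; in the
   cone both errors are controlled by the modulus of [x 0 0]. *)
have cone x : near_row (4 * r) 0 x -> (forall j, normc (x 0 j) <= normc (x 0 0)) ->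
    normc (g x - lambda * x 0 0) <= 2 * e * normc (x 0 0).
  move=> xr xcone.
  have x'r : near_row (4 * r) 0 (set0th x 0).
    by apply: near_row_set0th => //; rewrite mxE subrr normc0 mulr_gt0.
  have g'0 : g (set0th x 0) = 0.
    have := g0k _ (rd _ x'r).1; rewrite set0th0 expr0n gtn_eqF//.
    by move=> /eqP; rewrite expf_eq0 => /andP[_ /eqP].
  have Lx : L x = L (set0th x 0) + lambda * x 0 0.
    rewrite -{1}[x](set0th_id x) -(set0th_set0th x 0) set0thE set0th0 subr0.
    by rewrite linearD linearZ /= [_ *: _]mulrC.
  have nx : `|x| <= (normc (x 0 0))%:C.
    by apply: row_norm_le => j; rewrite normC_normc lecR.
  have nx' : `|set0th x 0| <= (normc (x 0 0))%:C.
    apply: row_norm_le => j; rewrite normC_normc lecR mxE; case: ifP => // _.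
    by rewrite normc0 normc_ge0.
  have h1 := le_trans (gL _ xr) (ler_wpM2l (ltW e0C) nx).
  have := le_trans (gL _ x'r) (ler_wpM2l (ltW e0C) nx').
  rewrite g'0 sub0r normrN => h2.
  rewrite -lecR -normC_normc.
  have -> : g x - lambda * x 0 0 = (g x - L x) + L (set0th x 0) by rewrite Lx; ring.
  apply: (le_trans (ler_normD _ _)); apply: (le_trans (lerD h1 h2)).
  by rewrite -mulrDl -rmorphD -rmorphM lecR; lra.
have ratio x : near_row (4 * r) 0 x -> (forall j, normc (x 0 j) <= normc (x 0 0)) -> x 0 0 != 0 ->
    (g x / x 0 0) ^+ k = 1 /\ normc (g x / x 0 0 - lambda) <= 2 * e.
  move=> xr xcone x0; split.
    by rewrite expr_div_n /g (g0k _ (rd _ xr).1) divff// expf_neq0.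
  have := cone x xr xcone.
  have -> : g x - lambda * x 0 0 = (g x / x 0 0 - lambda) * x 0 0 by rewrite mulrBl divfK.
  by rewrite normcM ler_pM2r// lt_def normc_ge0 normc_eq0 x0.
(* A sample point on the axis of the cone, used to read off [eta]. *)
pose xs : V := set0th 0 r%:C.
have rC0 : r%:C != 0 :> C by rewrite eq_complex /= eqxx andbT gt_eqF.
have nr : normc r%:C = r by rewrite normc_real gtr0_norm.
have r4 : r < 4 * r by lra.
have [|||eta_k eta_l] := ratio xs.
- apply: near_row_set0th; first by move=> j; rewrite subrr normc0 mulr_gt0.
  by rewrite mxE subr0 nr.
- by move=> j; rewrite set0th0 mxE; case: ifP => // _; rewrite mxE normc0 normc_ge0.
- by rewrite set0th0.
set eta := g xs / xs 0 0 in eta_k eta_l.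
exists eta => //.
have g_cone x : near_row (4 * r) 0 x -> (forall j, normc (x 0 j) <= normc (x 0 0)) -> x 0 0 != 0 ->
    g x = eta * x 0 0.
  move=> xr xcone x0; have [rk rl] := ratio x xr xcone x0.
  rewrite -[LHS](divfK x0); congr (_ * _); apply: root_of_unity_gap => //.
  have -> : g x / x 0 0 - eta = (g x / x 0 0 - lambda) - (eta - lambda) by ring.
  apply: (le_lt_trans (normc_triangle _ _)); rewrite [normc (- _)]normcN.
  have -> : 1 / k%:R = 8 * e by rewrite /e; field; rewrite pnatr_eq0 -lt0n k_gt0.
  lra.
have g_lin x : near_row r 0 x -> g x = eta * x 0 0.
  move=> xr; pose phi z := g (set0th x z) - eta * z.
  have near_box z : box r z -> near_row (4 * r) 0 (set0th x z).
    move=> /andP[z1 z2]; apply: near_row_set0th; first by move=> j; apply: lt_trans (xr j) r4.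
    by rewrite mxE subr0; have := normc_le_ReIm z; lra.
  have phid z : box r z -> differentiable phi z.
    move=> zr; apply: differentiableB.
      apply: (@differentiable_comp _ _ _ _ (set0th x) g).
        exact: differentiable_set0th_slice.
      by apply: dg; exact: (rd _ (near_box z zr)).1.
    have idz : differentiable (id : C -> C) z by [].
    exact: (differentiableM (differentiable_cst eta z) idz).
  have : normc (phi (x 0 0)) <= 0.
    apply: (@maximum_principle R phi [::] r 0 r0).
    - by move=> z zr; apply: differentiable_continuous; exact: phid.
    - by move=> z /open_box_sub zr _; exact: phid.
    (* On the boundary of the box coordinate 0 dominates the others, which are less than [r], so
       [phi] vanishes there by [g_cone]. *)
    - move=> z zr zb; have rz := box_boundary zr zb.
      rewrite /phi g_cone ?set0th0 ?subrr ?normc0//.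
      + exact: near_box.
      + move=> j; rewrite mxE; case: ifP => // _; apply: le_trans rz.
        by have := xr j; rewrite mxE subr0 => /ltW.
      + by rewrite -normc_eq0 gt_eqF//; apply: lt_le_trans rz.
    - by apply/open_box_sub/andP; have := xr 0; rewrite mxE subr0 => h; split;
        apply: le_lt_trans h; [exact: norm_Re_le|exact: norm_Im_le].
  rewrite le_eqVlt ltNge normc_ge0 orbF normc_eq0 /phi set0th_id subr_eq0.
  by move=> /eqP.
apply/near_rowP; exists r => // x xr; apply/rowP => j; rewrite mxE.
have xd : near_row d 0 x by apply: (rd _ _).1 => i; apply: lt_trans (xr i) r4.
case: ifP => j0; last by rewrite gj ?j0.
by have -> : j = 0; [apply/val_inj/eqP|exact: g_lin].
Qed.

(** If [eta] had order less than [k], so would [gamma]: polydiscs are stable under multiplication of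
    coordinate 0 by [eta], so iterates can be computed on them. *)
Lemma fold_symmetry_primitive (gamma : V -> V) (eta : C) : eta ^+ k = 1 ->
  germ_eq gamma (fun x => set0th x (eta * x 0 0)) -> germ_order gamma k ->
  k.-primitive_root eta.
Proof.
move=> etak /near_rowP[d d0 dP] [_ _ kmin].
have [m m_prim mk] := prim_order_exists k_gt0 etak.
have [mk'|km] := ltnP m k; last first.
  by have := dvdn_leq k_gt0 mk => mk'; rewrite (_ : k = m)//; apply/eqP; rewrite eqn_leq km mk'.
case: (kmin m); first by rewrite mk' (prim_order_gt0 m_prim).
apply/near_rowP; exists d => // x xd.
have neta := normc_root_of_unity etak.
have iterE i : iter i gamma x = set0th x (eta ^+ i * x 0 0).
  elim: i => [|i IH]; first by rewrite expr0 mul1r set0th_id.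
  rewrite iterS IH dP ?set0th_set0th ?set0th0 ?mulrA ?exprS//.
  apply: near_row_set0th => //; rewrite mxE subr0 normcM normcX neta expr1n mul1r.
  by have := xd 0; rewrite mxE subr0.
by rewrite iterE (prim_expr_order m_prim) mul1r set0th_id.
Qed.

End FoldSymmetry.

(** * Germs of folds *)

Section Germs.
Variables (R : realType) (n : nat).
Local Notation C := (CC R).
Local Notation V := (Cn R n).
Implicit Types f g h : V -> V.

Lemma holo_germ_cvg h : holo_germ h -> h @ (0 : V) --> (0 : V).
Proof.
move=> [h0 /nbhs_singleton dh]; rewrite -{2}h0.
exact: (differentiable_continuous dh).
Qed.

Lemma near_holo_germ h (P : V -> Prop) : holo_germ h ->
  (\forall x \near (0 : V), P x) -> \forall x \near (0 : V), P (h x).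
Proof. by move=> /holo_germ_cvg hc nP; exact: (hc P nP). Qed.

Lemma holo_germ_comp f g : holo_germ f -> holo_germ g -> holo_germ (f \o g).
Proof.
move=> hf hg; case: (hf) (hg) => f0 df [g0 dg]; split; first by rewrite /= g0.
have dfg := near_holo_germ hg df.
move: dg dfg; apply: filterS2 => x dgx dfx.
exact: (differentiable_comp dgx dfx).
Qed.

Lemma inverse_germs_sym h h' : inverse_germs h h' -> inverse_germs h' h.
Proof. by case=> ? ? ? ?; split. Qed.

Lemma inverse_germs_comp f f' g g' : inverse_germs f f' -> inverse_germs g g' ->
  inverse_germs (f \o g) (g' \o f').
Proof.
move=> [hf hf' f'f ff'] [hg hg' g'g gg']; split; try exact: holo_germ_comp.
  move: g'g (near_holo_germ hg f'f); apply: filterS2 => x /= g'gx f'fx.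
  by rewrite f'fx.
move: ff' (near_holo_germ hf' gg'); apply: filterS2 => x /= ff'x gg'x.
by rewrite gg'x.
Qed.

End Germs.

(** * Factorization through folds and equivalence *)

Section Folds.
Variables (R : realType) (n k : nat).
Local Notation C := (CC R).
Local Notation V := (Cn R n.+1).
Hypothesis k_gt0 : (0 < k)%N.
Local Notation F := (@standard_fold R n.+1 k).

Lemma standard_foldE (x : V) : F x = set0th x (x 0 0 ^+ k).
Proof.
apply/rowP => j; rewrite !mxE; case: ifP => // /eqP j0.
by rewrite (_ : j = 0)//; apply/val_inj.
Qed.

Lemma standard_fold_root (y : V) : F (set0th y (k.-root (y 0 0))) = y.
Proof. by rewrite standard_foldE set0th_set0th set0th0 rootCK// set0th_id. Qed.

Lemma set0th00 : set0th (0 : V) 0 = 0.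
Proof. by apply/rowP => j; rewrite !mxE if_same. Qed.

Lemma holo_standard_fold : holo_germ F.
Proof.
have dF x : differentiable F x.
  rewrite (_ : F = fun y => set0th y (y 0 0 ^+ k)); last first.
    by apply/funext => y; exact: standard_foldE.
  apply: (@differentiable_set0th _ _ (fun y : V => y 0 0 ^+ k)).
  rewrite -(prednK k_gt0).
  have := differentiableX k.-1 (differentiable_coord x 0 0).
  by rewrite exprfctE.
split; first by rewrite standard_foldE mxE expr0n gtn_eqF// set0th00.
by near=> x; exact: dF.
Unshelve. all: by end_near. Qed.

(** The chosen right inverse of the fold tends to 0 at 0, because the modulus of a root is the root
    of the modulus. *)
Lemma near_standard_fold_root (P : V -> Prop) :
  (\forall x \near (0 : V), P x) -> \forall y \near (0 : V), P (set0th y (k.-root (y 0 0))).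
Proof.
move=> /near_rowP[d d0 dP]; apply/near_rowP.
exists (Num.min d (d ^+ k)); first by rewrite lt_min d0 exprn_gt0.
move=> y yd; apply: dP; apply: near_row_set0th.
  by move=> j; apply: lt_le_trans (yd j) _; rewrite ge_min lexx.
rewrite mxE subr0 -(@ltr_pXn2r _ k) ?nnegrE ?normc_ge0//; last exact: ltW.
rewrite -normcX rootCK//; have := yd 0; rewrite mxE subr0 => /lt_le_trans; apply.
by rewrite ge_min lexx orbT.
Qed.

(** Powers of [eta] exhaust the k-th roots of unity, so the quotient construction applies to each
    coordinate of [G]; the bound 1 on them comes from continuity at 0. *)
Lemma invariant_factors_through_fold (eta : C) (G : V -> V) :
  k.-primitive_root eta -> holo_germ G ->
  germ_eq (fun x => G (set0th x (eta * x 0 0))) G ->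
  exists2 M : V -> V, holo_germ M & germ_eq (M \o F) G.
Proof.
move=> eta_prim hG Geta; case: (hG) => G0 dG.
have neta : normc eta = 1 := normc_root_of_unity k_gt0 (prim_expr_order eta_prim).
have G1 : \forall x \near (0 : V), near_row 1 0 (G x).
  by apply: (near_holo_germ hG); apply/near_rowP; exists 1.
have [d d0 dP] : exists2 d : R, 0 < d & forall x, near_row d 0 x ->
    [/\ differentiable G x, near_row 1 0 (G x) & G (set0th x (eta * x 0 0)) = G x].
  have /near_rowP[d d0 dP] : \forall x \near (0 : V),
      [/\ differentiable G x, near_row 1 0 (G x) & G (set0th x (eta * x 0 0)) = G x].
    by move: dG G1 Geta; apply: filterS3.
  by exists d.
have Ginv x (w : C) : near_row d 0 x -> w ^+ k = 1 -> G (set0th x (w * x 0 0)) = G x.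
  move=> xd /(prim_rootP eta_prim)[i ->]; elim: (nat_of_ord i) => {i} [|i IH].
    by rewrite expr0 mul1r set0th_id.
  have xi : near_row d 0 (set0th x (eta ^+ i * x 0 0)).
    apply: near_row_set0th => //; rewrite mxE subr0 normcM normcX neta expr1n mul1r.
    by have := xd 0; rewrite mxE subr0.
  by have [_ _] := dP _ xi; rewrite set0th_set0th set0th0 mulrA -exprS IH.
pose M (y : V) : V := G (set0th y (k.-root (y 0 0))).
pose Gj j (x : V) : C := G x 0 j.
have Gj_diff j x : near_row d 0 x -> differentiable (Gj j) x.
  by move=> /dP[dGx _ _]; exact: (differentiable_comp dGx (differentiable_coord (G x) 0 j)).
have Gj_bound j x : near_row d 0 x -> normc (Gj j x) <= 1.
  by move=> /dP[_ /(_ j) + _]; rewrite mxE subr0 => /ltW.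
have Gj_inv j x (w : C) : near_row d 0 x -> w ^+ k = 1 -> Gj j (set0th x (w * x 0 0)) = Gj j x.
  by move=> xd wk; rewrite /Gj Ginv.
have near_d' : \forall y \near (0 : V), near_row (Num.min d (d ^+ k)) 0 y.
  by apply/near_rowP; exists (Num.min d (d ^+ k)); rewrite // lt_min d0 exprn_gt0.
exists M.
  split.
    by rewrite /M [(0 : V) 0 0]mxE rootC0 set0th00.
  move: near_d'; apply: filterS => y yd.
  have -> : M = \sum_(j < n.+1) (fun y => fold_quotient k (Gj j) y *: delta_mx 0 j).
    apply/funext => x; rewrite fct_sumE [LHS]row_sum_delta.
    by apply: eq_bigr.
  apply: differentiable_sum => j; apply: differentiableZl.
  exact: (fold_quotient_differentiable k_gt0 d0 (Gj_diff j) (Gj_bound j) (Gj_inv j) yd).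
have := near_holo_germ holo_standard_fold near_d'.
apply: filterS => x xd; apply/rowP => j.
rewrite /= -[RHS]/(Gj j x) -[LHS]/(fold_quotient k (Gj j) (F x)).
rewrite (fold_quotientE k_gt0 d0 (Gj_inv j) xd (s := x 0 0)).
  by rewrite standard_foldE set0th_set0th set0th_id.
by rewrite standard_foldE set0th0.
Qed.

(** The conjugate [gamma] of [beta] by [A] is a symmetry of the fold of order [k], hence multiplies
    coordinate 0 by a primitive root. The map [E \o B] is invariant under it and so factors through
    the fold. *)
Lemma fold_factorization (A B E beta : V -> V) :
  inverse_germs A B -> holo_germ E -> holo_germ beta -> germ_order beta k ->
  germ_eq (F \o A \o beta) (F \o A) -> germ_eq (E \o beta) E ->
  exists2 M : V -> V, holo_germ M & germ_eq E (M \o F \o A).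
Proof.
move=> [hA hB BA AB] hE hb ob FA Eb.
pose gamma := A \o beta \o B.
have hg : holo_germ gamma := holo_germ_comp (holo_germ_comp hA hb) hB.
have hbB := holo_germ_comp hb hB.
have Fg : germ_eq (F \o gamma) F.
  move: AB (near_holo_germ hB FA); apply: filterS2 => x /= ABx FAx.
  by rewrite FAx ABx.
have iterg m : germ_eq (iter m gamma) (A \o iter m beta \o B).
  elim: m => [|m IH]; first by move: AB; apply: filterS => x /= ->.
  have hbm : holo_germ (iter m beta).
    elim: m {IH} => [|m IH]; last exact: (holo_germ_comp hb IH).
    by split => //; near=> x.
  move: IH (near_holo_germ (holo_germ_comp hbm hB) BA); apply: filterS2 => x /= -> BAx.
  by rewrite /gamma /= BAx.
have og : germ_order gamma k.
  case: ob => [_ bk bm]; split => // [|m mk gm].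
    move: (iterg k) (near_holo_germ hB bk) AB; apply: filterS3 => x /= -> ->.
    by [].
  (* An iterate of [gamma] that is trivial near 0 is conjugated back by [A] to a trivial iterate of
     [beta]. *)
  apply: (bm m mk).
  have hbm : holo_germ (iter m beta).
    elim: m {mk gm} => [|m IH]; last exact: (holo_germ_comp hb IH).
    by split => //; near=> x.
  have := near_holo_germ hA (iterg m); have := near_holo_germ hA gm.
  move=> gmA itA.
  have BAb := near_holo_germ hbm BA.
  near=> x.
  have e1 : iter m gamma (A x) = A x by near: x.
  have e2 : iter m gamma (A x) = A (iter m beta (B (A x))) by near: x.
  have e3 : B (A x) = x by near: x.
  have e4 : B (A (iter m beta x)) = iter m beta x by near: x.
  by rewrite -e4 -[x in iter m beta x]e3 -e2 e1 e3.
have [eta etak gE] := fold_symmetry_linear k_gt0 hg Fg.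
have eta_prim := fold_symmetry_primitive k_gt0 etak gE og.
have hEB := holo_germ_comp hE hB.
have [|M hM MF] := invariant_factors_through_fold eta_prim hEB.
  move: gE (near_holo_germ hbB BA) (near_holo_germ hB Eb); apply: filterS3 => x /= gx BAx Ex.
  by rewrite -gx /gamma /= BAx Ex.
exists M => //; have := near_holo_germ hA MF; move: BA; apply: filterS2 => x /= BAx ->.
by rewrite BAx.
Unshelve. all: by end_near. Qed.

(** Substituting one factorization in the other gives [N \o M \o F = F] near 0, and [F] cancels on
    the right by its right inverse [set0th y (k.-root (y 0 0))]. *)
Lemma fold_factor_inverse (A B D : V -> V) (M N : V -> V) :
  inverse_germs A B -> germ_eq (F \o D) (M \o F \o A) -> germ_eq (F \o A) (N \o F \o D) ->
  holo_germ D -> germ_eq (N \o M) id.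
Proof.
move=> [hA hB BA AB] FD FA hD.
have NMF : germ_eq (N \o M \o F) F.
  have := near_holo_germ hB FD; have := near_holo_germ hB FA; move: AB.
  by apply: filterS3 => x /= ABx; rewrite ABx => FAx FDx; rewrite -FDx -FAx.
have := near_standard_fold_root NMF; apply: filterS => y.
by rewrite /= standard_fold_root.
Qed.

Lemma folds_left_equivalent (p g beta : V -> V) : is_fold k p -> is_fold k g ->
  holo_germ beta -> germ_order beta k ->
  germ_eq (p \o beta) p -> germ_eq (g \o beta) g ->
  exists2 l, biholo_germ l & germ_eq g (l \o p).
Proof.
move=> [l1 [B [A [[l1' il1] iBA pE]]]] [l2 [D [E [[l2' il2] iDE gE]]]] hb ob pb gb.
have hF := holo_standard_fold.
(* The left factor [l] is undone by [l'], so the invariance of [q] under [beta] descends to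
   [F \o h']. *)
have cancel l l' h h' q : inverse_germs l l' -> inverse_germs h h' ->
    germ_eq q (l \o F \o h') -> germ_eq (q \o beta) q -> germ_eq (F \o h' \o beta) (F \o h').
  move=> [hl hl' l'l _] [_ hh' _ _] qE qb.
  have hFh := holo_germ_comp hF hh'.
  have q1 := near_holo_germ hb qE.
  have q2 := near_holo_germ hFh l'l.
  have q3 := near_holo_germ hb q2.
  near=> x.
  have e1 : q x = l (F (h' x)) by near: x.
  have e2 : q (beta x) = l (F (h' (beta x))) by near: x.
  have e3 : q (beta x) = q x by near: x.
  have e4 : l' (l (F (h' x))) = F (h' x) by near: x.
  have e5 : l' (l (F (h' (beta x)))) = F (h' (beta x)) by near: x.
  by rewrite /= -e5 -e2 e3 e1 e4.
have FA := cancel _ _ _ _ _ il1 iBA pE pb.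
have FE := cancel _ _ _ _ _ il2 iDE gE gb.
have iAB := inverse_germs_sym iBA; have iED := inverse_germs_sym iDE.
have [hA hB _ _] := iAB; have [hE hD _ _] := iED.
(* The same factorization is used in both directions, and [M] and [N] are then inverse germs. *)
have [M hM ME] := fold_factorization iAB (holo_germ_comp hF hE) hb ob FA FE.
have [N hN NE] := fold_factorization iED (holo_germ_comp hF hA) hb ob FE FA.
have NM := fold_factor_inverse iAB ME NE hE.
have MN := fold_factor_inverse iED NE ME hA.
have iMN : inverse_germs M N by split.
exists (l2 \o M \o l1').
  exists (l1 \o (N \o l2')); apply: inverse_germs_comp; last exact: inverse_germs_sym.
  exact: inverse_germs_comp.
case: il1 => _ _ l1'l1 _; have q := near_holo_germ (holo_germ_comp hF hA) l1'l1.
near=> x.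
have e1 : g x = l2 (F (E x)) by near: x.
have e2 : p x = l1 (F (A x)) by near: x.
have e3 : F (E x) = M (F (A x)) by near: x.
have e4 : l1' (l1 (F (A x))) = F (A x) by near: x.
by rewrite e1 e3 /= e2 e4.
Unshelve. all: by end_near. Qed.

End Folds.

Lemma is_fold_comp_biholo (R : realType) (n k : nat) (p h h' : Cn R n -> Cn R n) :
  is_fold k p -> inverse_germs h h' -> is_fold k (p \o h').
Proof.
move=> [l [B [A [bl iBA pE]]]] ih; exists l, (h \o B), (A \o h'); split => //.
  exact: inverse_germs_comp.
by case: ih => _ hh' _ _; have := near_holo_germ hh' pE; apply: filterS.
Qed.

Theorem theorem4p3 (R : realType) (n s : nat) (k : 'I_s -> nat)
    (p g alpha beta : 'I_s -> Cn R n -> Cn R n)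
    (n_ge2 : (2 <= n)%N) (s_bounds : (1 <= s <= n)%N)
    (k_ge2 : forall i, (2 <= k i)%N)
    (p_diagram : divergent_diagram k p) (g_diagram : divergent_diagram k g)
    (alpha_reflection : forall i, is_reflection (alpha i))
    (beta_reflection : forall i, is_reflection (beta i))
    (alpha_order : forall i, germ_order (alpha i) (k i))
    (beta_order : forall i, germ_order (beta i) (k i))
    (p_assoc : associated p alpha) (g_assoc : associated g beta) :
  equivalent_tuples alpha beta -> equivalent_diagrams p g.
Proof.
destruct n as [|m]; first by [].
move=> [h [h' [ih betaE]]]; case: (ih) => hh hh' h'h _.
have holo (f : Cn R m.+1 -> Cn R m.+1) : is_reflection f -> holo_germ f.
  by case=> -[f' []].
have /choice[l lP] : forall i, exists l, biholo_germ l /\ germ_eq (g i) (l \o (p i \o h')).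
  move=> i; have hb := holo _ (beta_reflection i); have ha := holo _ (alpha_reflection i).
  (* Since [beta i] is [h \o alpha i \o h'] near 0, pulling [p i] back by [h'] makes it invariant
     under [beta i]. The change of source [h] is common to all [i], and only changes of target
     remain to be found, one for each [i]. *)
  have ph_beta : germ_eq ((p i \o h') \o beta i) (p i \o h').
    have h'hah' := near_holo_germ (holo_germ_comp ha hh') h'h.
    have := near_holo_germ hh' (p_assoc i); move: (betaE i) h'hah'.
    by apply: filterS3 => x /= -> ->.
  have pf := is_fold_comp_biholo (p_diagram i) ih.
  have [|l bl gl] := folds_left_equivalent _ pf (g_diagram i) hb (beta_order i) ph_beta (g_assoc i).
    exact: ltnW.
  by exists l.
by exists l, h, h'; split => // i; have [] := lP i.
Qed.
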